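(* There is a randomized distributed algorithm for the maximal independent set (MIS) problem in the $\mathsf{CONGEST}$ model with time complexity $O(\log^2 n)$ and energy complexity $O(\log\log n)$. That is, on any $n$-node graph $G$ the algorithm runs for $O(\log^2 n)$ rounds, each node is awake in only $O(\log\log n)$ rounds, and the algorithm computes an independent set of vertices of $G$ which, with high probability, is maximal.
   Context: The network is an $n$-node undirected graph $G=(V,E)$; each node is a processor that initially knows only its neighbors (and a polynomial upper bound on $n$). Computation proceeds in synchronous rounds; in the $\mathsf{CONGEST}$ model, in each round every node may perform local computation and send one message of $O(\log n)$ bits to each neighbor. In every round each node is either awake or sleeping; a sleeping node performs no computation and sends/receives no messages, and it wakes only at times it has scheduled itself. The time complexity is the number of rounds until all nodes terminate; the energy complexity is the maximum over nodes of the number of rounds in which that node is awake. An independent set is a set of pairwise non-adjacent vertices; it is maximal if every vertex not in it has a neighbor in it. ''With high probability'' means with probability at least $1-n^{-c}$ for some constant $c>0$. At the end, each node must know whether it is in the computed set. *)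

(* Defs.v *)
From mathcomp Require Import all_boot.
Set Implicit Arguments. Unset Printing Implicit Defensive.

(* A (uniform) distributed algorithm: every node runs the same local program.
   - St      : local state space (local computation is unrestricted);
   - rbits N : number of private random bits each node draws (N = known
               polynomial upper bound on n);
   - init N i nbrs bits : initial state of a node with identifier i, whose
               neighbours have the (sorted) identifiers nbrs, and random bits;
   - wake s  : the next round at which the node is scheduled to be awake
               (None = the node has terminated);
   - send s r j : message (a natural number, or nothing) sent in round r to
               the neighbour with identifier j, when awake;
   - step s r msgs : new state after an awake round r, having received the
               list msgs of (sender identifier, message) pairs;
   - output s : whether the node is in the computed set. *)
Record algo := Algo {
  St : Type;
  rbits : nat -> nat;
  init : nat -> nat -> seq nat -> seq bool -> St;
  wake : St -> option nat;
  send : St -> nat -> nat -> option nat;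
  step : St -> nat -> seq (nat * nat) -> St;
  output : St -> bool }.

Definition is_awake (A : algo) (s : St A) (r : nat) : bool := wake A s == Some r.

Definition nbr_ids n (e : rel 'I_n) (id : 'I_n -> nat) (v : 'I_n) : seq nat :=
  sort leq [seq id u | u <- enum 'I_n & e v u].

Definition received (A : algo) n (e : rel 'I_n) (id : 'I_n -> nat)
    (c : 'I_n -> St A) (r : nat) (v : 'I_n) : seq (nat * nat) :=
  sort (fun a b => a.1 <= b.1)
    (pmap (fun u => if e v u && is_awake A (c u) r
                    then omap (fun m => (id u, m)) (send A (c u) r (id v))
                    else None) (enum 'I_n)).

(* run ... r v = state of node v at the beginning of round r (rounds 0,1,...).
   A sleeping node's state does not change. *)
Fixpoint run (A : algo) n (e : rel 'I_n) (N : nat) (id : 'I_n -> nat)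
    (rnd : 'I_n -> seq bool) (r : nat) : 'I_n -> St A :=
  match r with
  | 0 => fun v => init A N (id v) (nbr_ids e id v) (rnd v)
  | r'.+1 => let c := run A e N id rnd r' in
             fun v => if is_awake A (c v) r' then step A (c v) r' (received A e id c r' v)
                      else c v
  end.

Definition energy (A : algo) n (e : rel 'I_n) N id rnd (T : nat) (v : 'I_n) : nat :=
  count (fun r => is_awake A (run A e N id rnd r v) r) (iota 0 T).

Definition independent n (e : rel 'I_n) (S : {set 'I_n}) : bool :=
  [forall u, forall v, e u v ==> ~~ ((u \in S) && (v \in S))].

Definition maximal_independent n (e : rel 'I_n) (S : {set 'I_n}) : bool :=
  independent e S && [forall v, (v \in S) || [exists u, e v u && (u \in S)]].

Definition out_set (A : algo) n (e : rel 'I_n) N id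
    (f : {ffun 'I_n -> (rbits A N).-tuple bool}) (T : nat) : {set 'I_n} :=
  [set v | output A (run A e N id (fun v => tval (f v)) T v)].

(* Main.v *)
Require Import Defs.
From mathcomp Require Import all_boot all_order all_algebra all_field.
From mathcomp Require Import zify ring lra.
Set Implicit Arguments. Unset Strict Implicit. Unset Printing Implicit Defensive.
Import Order.TTheory GRing.Theory Num.Theory.

(** Time is cut into slots.  In a run every node owns at most one slot, and an
    undecided node joins the set at its slot unless an undecided neighbour owns the
    same slot.  Two nodes with slots [s < t] are both awake at some common time in
    [(s, t]], although each is awake only O(log (number of slots)) times; this is how a
    node learns, before its own slot, which neighbours have already joined.

    Suppose that in every slot each unused node takes the slot with probability [x / D],
    where [D] bounds the number of unused undecided neighbours.  A node with more than
    [D / 2] such neighbours is then dominated with probability at least [x / 4] per slot,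
    so O(log n / x) slots halve the degree.  Nodes that lose a collision remain
    undecided, and the exponential moment of their number around a fixed node grows
    only by a factor [1 + 2 x^2] per slot.  A first run with constant [x] needs
    O(log^2 n) slots and leaves O(log^2 n) losers around each node.  A second
    run therefore starts with [D] of order log^2 n; it can afford to halve [x] at each
    phase, and leaves only O(log n) undecided neighbours.  Two steps of Linial's colour
    reduction then give a proper colouring with O(log^2 n) colours, which are the slots
    of a third, collision-free run. *)

(** * Random subsets *)

Section RandomSets.
Variable V : finType.
Implicit Types (S M : {set V}) (p : rat).
Local Open Scope ring_scope.

Definition weight p M : rat := \prod_v (if v \in M then p else 1 - p).

Definition expect p (F : {set V} -> rat) : rat := \sum_(M : {set V}) weight p M * F M.

Lemma weight_ge0 p M : 0 <= p <= 1 -> 0 <= weight p M.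
Proof.
by move=> /andP[p0 p1]; apply: prodr_ge0 => v _; case: ifP; rewrite ?subr_ge0.
Qed.

Lemma eq_expect p F G : F =1 G -> expect p F = expect p G.
Proof. by move=> eqFG; apply: eq_bigr => M _; rewrite eqFG. Qed.

Lemma expectD p F G : expect p (fun M => F M + G M) = expect p F + expect p G.
Proof. by rewrite -big_split; apply: eq_bigr => M _; rewrite mulrDr. Qed.

Lemma expectZ p c F : expect p (fun M => c * F M) = c * expect p F.
Proof. by rewrite /expect mulr_sumr; apply: eq_bigr => M _; rewrite mulrCA. Qed.

Lemma expect_sum (I : Type) (r : seq I) (P : pred I) p (F : I -> {set V} -> rat) :
  expect p (fun M => \sum_(i <- r | P i) F i M) = \sum_(i <- r | P i) expect p (F i).
Proof. by rewrite exchange_big; apply: eq_bigr => M _; rewrite mulr_sumr. Qed.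

Lemma ler_expect p F G : 0 <= p <= 1 -> (forall M, F M <= G M) -> expect p F <= expect p G.
Proof.
by move=> p01 leFG; apply: ler_sum => M _; rewrite ler_wpM2l ?weight_ge0.
Qed.

(** This is where independence enters: a product of per-element factors averages to a product, and
    the exact formulas below reduce to it. *)
Lemma expect_prod p (a b : V -> rat) :
  expect p (fun M => \prod_v (if v \in M then a v else b v))
  = \prod_v (p * a v + (1 - p) * b v).
Proof.
rewrite bigA_distr; apply: eq_bigr => M _; rewrite -big_split.
by apply: eq_bigr => v _; case: ifP.
Qed.

Lemma expect_subset p S : expect p (fun M => (S \subset M)%:R) = p ^+ #|S|.
Proof.
rewrite (eq_expect p (G := fun M => \prod_v (if v \in M then 1 else (v \notin S)%:R))).
  rewrite expect_prod -prodr_const [RHS]big_mkcond.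
  by apply: eq_bigr => v _; case: (v \in S) => /=; ring.
move=> M; case: (boolP (S \subset M)) => [/subsetP sSM|/subsetPn[v vS vM]].
  by rewrite big1 // => v _; case: ifPn => // /(contra (sSM v)) ->.
by rewrite (bigD1 v) //= (negbTE vM) vS mul0r.
Qed.

Lemma expect_cst p c : expect p (fun=> c) = c.
Proof.
rewrite (eq_expect p (G := fun M => c * (set0 \subset M)%:R)) ?expectZ.
  by rewrite expect_subset cards0 mulr1.
by move=> M; rewrite sub0set mulr1.
Qed.

Lemma expect_exp2 p S : expect p (fun M => 2 ^+ #|S :&: M|) = (1 + p) ^+ #|S|.
Proof.
rewrite (eq_expect p (G := fun M => \prod_v (if v \in M then (if v \in S then 2 else 1) else 1))).
  rewrite expect_prod -prodr_const [RHS]big_mkcond.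
  by apply: eq_bigr => v _; case: (v \in S) => /=; ring.
move=> M; rewrite -prodr_const big_mkcond; apply: eq_bigr => v _.
by rewrite inE; case: (v \in S); case: (v \in M).
Qed.

Lemma expect_card p S : expect p (fun M => #|S :&: M|%:R) = #|S|%:R * p.
Proof.
rewrite (eq_expect p (G := fun M => \sum_(v in S) ([set v] \subset M)%:R)).
  rewrite expect_sum (eq_bigr (fun=> p)) ?sumr_const ?mulr_natl //.
  by move=> v _; rewrite expect_subset cards1.
move=> M; rewrite -sum1_card natr_sum big_mkcond [RHS]big_mkcond.
by apply: eq_bigr => v _; rewrite inE sub1set; case: (v \in S); case: (v \in M).
Qed.

End RandomSets.

(** * Elementary bounds on powers of numbers near 1 *)

Section NumericBounds.
Local Open Scope ring_scope.
Variable F : realFieldType.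
Implicit Types (x p : F) (m d : nat).

Lemma bernoulli_le x m : x <= 1 -> 1 - m%:R * x <= (1 - x) ^+ m.
Proof.
move=> x1; elim: m => [|m IH]; first by rewrite mul0r subr0 expr0.
rewrite exprS; apply: (le_trans (y := (1 - x) * (1 - m%:R * x))).
  rewrite -natr1; have: 0 <= m%:R * (x * x) by rewrite mulr_ge0 // -expr2 sqr_ge0.
  by nra.
by rewrite ler_wpM2l // subr_ge0.
Qed.

(** By Bernoulli [(1 + x) ^+ m] is at least 2, and its product with [(1 - x) ^+ m] is at most 1. *)
Lemma exp_decay x m : 0 <= x <= 1 -> m%:R * x = 1 -> (1 - x) ^+ m <= 1 / 2.
Proof.
move=> /andP[x0 x1] mx; have := bernoulli_le (x := - x) m.
rewrite opprK mulrN opprK mx => /(_ ltac:(lra)) ge2.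
have pos : 0 <= (1 - x) ^+ m by rewrite exprn_ge0 // subr_ge0.
have : (1 - x) ^+ m * (1 + x) ^+ m <= 1.
  by rewrite -exprMn exprn_ile1 // -subr_sqr expr1n ?subr_ge0 ?gerBl ?sqr_ge0 // expr_le1.
by nra.
Qed.

(** Second-order precision matters: in the estimate of the losers the linear term cancels and only
    the quadratic remainder counts. *)
Lemma exp_quadratic p d : 0 <= p -> d%:R * p <= 1 ->
  (1 + p) ^+ d <= 1 + d%:R * p + (d%:R * p) ^+ 2.
Proof.
move=> p0; elim: d => [|d IH] dp; first by rewrite expr0 mul0r expr0n /= !addr0.
have dp' : d%:R * p <= 1 by move: dp; rewrite -natr1; nra.
have h := IH dp'; have d0 : (0 : F) <= d%:R by [].
rewrite exprSr; apply: (le_trans (y := (1 + d%:R * p + (d%:R * p) ^+ 2) * (1 + p))).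
  by rewrite ler_wpM2r // addr_ge0.
rewrite -natr1; have : 0 <= (1 - d%:R * p) * (d%:R * p) * p by rewrite !mulr_ge0 // subr_ge0.
have: 0 <= p ^+ 2 by rewrite sqr_ge0.
have: 0 <= d%:R * p ^+ 2 by rewrite mulr_ge0 // sqr_ge0.
by nra.
Qed.

End NumericBounds.
(** * One slot *)

Section SlotProcess.
Variables (V : finType) (e : rel V).
Hypothesis e_irr : irreflexive e.

(* [spent] holds the nodes whose slot in the current run has passed; those among them
   that are still undecided are the losers of a collision. *)
Record config := Config { joined : {set V}; undec : {set V}; spent : {set V} }.
Implicit Types (c : config) (M : {set V}) (D F : nat).

Definition nbrs v := [set u | e v u].
Definition active c := undec c :\: spent c.
Definition winners c M :=
  [set u in active c :&: M | [forall w in active c :&: M, ~~ e u w]].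
Definition slot_step c M :=
  Config (joined c :|: winners c M)
         (undec c :\: (winners c M :|: [set v | [exists u in winners c M, e v u]]))
         (spent c :|: M).
Definition refresh c := Config (joined c) (undec c) set0.

Definition low_degree D c := [forall v in undec c, #|nbrs v :&: active c| <= D].
Definition spent_nbrs c v := nbrs v :&: undec c :&: spent c.

Lemma undec_step c M : undec (slot_step c M) \subset undec c.
Proof. exact: subsetDl. Qed.

Lemma active_step c M : active (slot_step c M) \subset active c.
Proof. by apply: setDSS; [exact: undec_step | exact: subsetUl]. Qed.

Lemma low_degree_step D c M : low_degree D c -> low_degree D (slot_step c M).
Proof.
move=> /'forall_implyP lowD; apply/'forall_implyP => v vU.
apply: leq_trans (lowD v (subsetP (undec_step c M) v vU)).
by apply: subset_leq_card; apply: setIS; apply: active_step.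
Qed.

Definition losers c v M :=
  [set u in nbrs v :&: active c :&: M | [exists w in active c :&: M, e u w]].

(** A neighbour that takes the slot and does not lose dominates [v]; so if [v] is still undecided,
    all of them lost. *)
Lemma losersE c v M : v \in undec (slot_step c M) ->
  losers c v M = nbrs v :&: active c :&: M.
Proof.
rewrite !inE negb_or => /andP[/andP[_ /'exists_andP nojoin] _].
apply/setP => u; rewrite inE; case: (boolP (u \in nbrs v :&: active c :&: M)) => //=.
rewrite -setIA in_setI => /andP[vu uC]; apply: contraT => nwin.
case: nojoin; exists u; rewrite inE in vu; split=> //; rewrite inE uC.
apply/'forall_implyP => w wC; apply/negP => euw.
by case/existsP: nwin; exists w; rewrite wC.
Qed.

Lemma spent_nbrs_step c v M : v \in undec (slot_step c M) ->
  #|spent_nbrs (slot_step c M) v| <= #|spent_nbrs c v| + #|losers c v M|.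
Proof.
move=> vU; apply: leq_trans (leq_card_setU _ _); apply: subset_leq_card.
apply/subsetP => u /setIP[/setIP[vu uU'] uS'].
have uU := subsetP (undec_step c M) u uU'.
rewrite losersE // !(inE, uU) in uS' vu *; rewrite vu /=.
by move: uS'; case: (u \in spent c).
Qed.

Local Open Scope ring_scope.

Section OneSlot.
Variables (c : config) (v : V) (p : rat) (D : nat).
Hypotheses (p01 : 0 <= p <= 1) (lowD : low_degree D c) (vU : v \in undec c).
Let d := #|nbrs v :&: active c|.

Let dD : (d <= D)%N.
Proof. by move/'forall_implyP: lowD => /(_ v vU). Qed.

(** Each loser belongs to an adjacent pair taking the slot, an event of probability [p ^+ 2]; each
    of the [d] neighbours has at most [D] possible partners. *)
Lemma expect_losers : expect p (fun M => #|losers c v M|%:R) <= d%:R * (D%:R * p ^+ 2).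
Proof.
pose f u w M : rat := ([set u; w] \subset M)%:R.
apply: (le_trans (y := expect p (fun M => \sum_(u in nbrs v :&: active c)
   \sum_(w in nbrs u :&: active c) f u w M))).
  apply: ler_expect => // M; rewrite -sum1_card natr_sum big_mkcond [leRHS]big_mkcond.
  apply: ler_sum => u _; rewrite !inE.
  have pos A : 0 <= \sum_(w in A) f u w M by apply: sumr_ge0.
  case: (e v u) => //=; case: (u \notin spent c) => //=; case: (u \in undec c) => //=.
  case: (boolP (u \in M)) => //= uM.
  case: ifP => [/'exists_andP[w]|//]; rewrite !inE => -[/andP[wA wM] euw].
  rewrite (bigD1 w) ?inE ?euw //= {1}/f subUset !sub1set uM wM lerDl.
  exact: sumr_ge0.
rewrite expect_sum /d mulr_natl -sumr_const; apply: ler_sum => u.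
rewrite !inE => /andP[_ /andP[_ uU]]; rewrite expect_sum.
apply: (le_trans (y := \sum_(w in nbrs u :&: active c) p ^+ 2)).
  apply: ler_sum => w; rewrite !inE => /andP[euw _].
  rewrite /f expect_subset cards2; case: eqVneq => // uw.
  by rewrite uw e_irr in euw.
rewrite sumr_const -[leLHS]mulr_natl ler_wpM2r ?sqr_ge0 // ler_nat.
by move/'forall_implyP: lowD => /(_ u uU).
Qed.

Lemma expect_stay D' : D = D'.*2 -> (D' < d)%N -> D%:R * p <= 1 / 8 ->
  expect p (fun M => (v \in undec (slot_step c M))%:R) <= 1 - D%:R * p / 4.
Proof.
move=> DD' dgt Dp; have /andP[p0 p1] := p01.
pose Y M : rat := #|nbrs v :&: active c :&: M|%:R.
(* With [y] marked active neighbours the majorant is [2 ^+ y - y >= 1] if [v] stays, since then all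
   [y] lose, and at least [2 ^+ y - 2 * y >= 0] otherwise. For [a = d p] and [x = D p] its mean is
   at most [1 - a + a ^+ 2 + a * x], where [x / 2 <= a <= x <= 1 / 8]. *)
apply: (le_trans (y := expect p (fun M => #|losers c v M|%:R
    + (2 ^+ #|nbrs v :&: active c :&: M| + (-2) * Y M)))).
  apply: ler_expect => // M; rewrite /Y /=; set y := #|_ :&: M|.
  have y1 : y%:R + 1 <= 2 ^+ y :> rat by rewrite natr1 -natrX ler_nat ltn_expl.
  have y2 : 2 * y%:R <= 2 ^+ y :> rat.
    rewrite -natrM -natrX ler_nat; case: (y) => // z.
    by rewrite expnS leq_mul2l ltn_expl.
  case: (boolP (v \in _)) => [vU'|_]; first by rewrite losersE // -/y mulr1n; lra.
  by rewrite mulr0n; have : 0 <= #|losers c v M|%:R :> rat by []; lra.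
rewrite !expectD expectZ expect_exp2 expect_card -/d.
have dDr : d%:R <= D%:R :> rat by rewrite ler_nat.
have d0 : 0 <= d%:R :> rat by [].
have dp : d%:R * p <= D%:R * p by rewrite ler_wpM2r.
have dp0 : 0 <= d%:R * p by rewrite mulr_ge0.
have := exp_quadratic (d := d) p0; have := expect_losers.
have D2 : D%:R <= 2 * d%:R :> rat by rewrite -natrM ler_nat DD'; lia.
have Dp2 : D%:R * p <= 2 * (d%:R * p) by rewrite mulrA ler_wpM2r.
set L := expect _ _; set E := (1 + p) ^+ d => h1 h2.
have {}h1 : L <= (d%:R * p) * (D%:R * p) by rewrite mulrACA -expr2 -mulrA.
have dp1 : d%:R * p <= 1 by lra.
have {}h2 := h2 dp1.
set a := d%:R * p in h1 h2 dp dp0 Dp2 *; set x := D%:R * p in h1 Dp dp Dp2 *.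
have : 0 <= a * (1 / 8 - x) by rewrite mulr_ge0 // subr_ge0.
have : 0 <= a * (x - a) by rewrite mulr_ge0 // subr_ge0.
by rewrite expr2 in h2 *; lra.
Qed.

Lemma expect_spent : D%:R * p <= 1 / 8 ->
  expect p (fun M => (v \in undec (slot_step c M))%:R * 2 ^+ #|spent_nbrs (slot_step c M) v|)
  <= (1 + 2 * (D%:R * p) ^+ 2) * 2 ^+ #|spent_nbrs c v|.
Proof.
move=> Dp; have /andP[p0 p1] := p01.
pose Y M : rat := #|nbrs v :&: active c :&: M|%:R.
(* If [v] stays, its [y] marked active neighbours all lose and the potential grows by at most
   [2 ^+ y = y + (2 ^+ y - y)]. In the mean the linear terms cancel. *)
apply: (le_trans (y := expect p (fun M => 2 ^+ #|spent_nbrs c v| *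
    (#|losers c v M|%:R + (2 ^+ #|nbrs v :&: active c :&: M| + (-1) * Y M))))).
  apply: ler_expect => // M; rewrite /Y /=; set y := #|_ :&: M|.
  have y1 : y%:R + 1 <= 2 ^+ y :> rat by rewrite natr1 -natrX ler_nat ltn_expl.
  case: (boolP (v \in _)) => [vU'|_]; last first.
    rewrite mul0r mulr_ge0 ?exprn_ge0 //.
    by have : 0 <= #|losers c v M|%:R :> rat by []; lra.
  rewrite mul1r losersE // -/y.
  apply: (le_trans (y := 2 ^+ #|spent_nbrs c v| * 2 ^+ y)).
    rewrite -exprD ler_weXn2l ?ler1n //.
    by have := spent_nbrs_step vU'; rewrite losersE.
  by rewrite ler_wpM2l ?exprn_ge0 //; lra.
rewrite expectZ !expectD expectZ expect_exp2 expect_card -/d mulrC.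
rewrite ler_wpM2r ?exprn_ge0 //.
have dDr : d%:R <= D%:R :> rat by rewrite ler_nat.
have dp : d%:R * p <= D%:R * p by rewrite ler_wpM2r.
have dp0 : 0 <= d%:R * p by rewrite mulr_ge0.
have := exp_quadratic (d := d) p0; have := expect_losers.
set L := expect _ _; set E := (1 + p) ^+ d => h1 h2.
have {}h1 : L <= (d%:R * p) * (D%:R * p) by rewrite mulrACA -expr2 -mulrA.
have dp1 : d%:R * p <= 1 by lra.
have {}h2 := h2 dp1.
set a := d%:R * p in h1 h2 dp dp0 *; set x := D%:R * p in h1 Dp dp *.
have : 0 <= (x + a) * (x - a) by rewrite mulr_ge0 ?subr_ge0 //; lra.
have : 0 <= x * (x - a) by rewrite mulr_ge0 ?subr_ge0 //; lra.
by rewrite !expr2 in h2 *; lra.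
Qed.

End OneSlot.

End SlotProcess.
(** * Runs *)

Section Runs.
Variables (V : finType) (e : rel V).
Hypothesis e_irr : irreflexive e.
Local Open Scope ring_scope.
Implicit Types (c : config V) (a : nat) (s : seq nat) (D F : nat).

(** Probabilities are powers of 1/2 because a node realizes them with [a] fair bits. *)
Definition chance a : rat := 2^-1 ^+ a.

Lemma chance01 a : 0 <= chance a <= 1.
Proof. by rewrite exprn_ge0 ?invr_ge0 //= exprn_ile1 ?invr_ge0 // invf_le1. Qed.

Lemma chance_gt0 a : 0 < chance a.
Proof. by rewrite exprn_gt0 ?invr_gt0. Qed.

Lemma chance_ge0 a : 0 <= chance a.
Proof. exact/ltW/chance_gt0. Qed.

Lemma chanceD a a' : chance (a + a') = chance a * chance a'.
Proof. exact: exprD. Qed.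

Lemma chanceV a : 2 ^+ a * chance a = 1.
Proof. by rewrite -exprMn mulfV // expr1n. Qed.

Fixpoint expects s (G : seq {set V} -> rat) : rat :=
  if s is a :: s' then expect (chance a) (fun M => expects s' (fun Ms => G (M :: Ms)))
  else G [::].

Definition mean s (G : config V -> rat) c := expects s (fun Ms => G (foldl (slot_step e) c Ms)).

Lemma mean_cons a s G c :
  mean (a :: s) G c = expect (chance a) (fun M => mean s G (slot_step e c M)).
Proof. by []. Qed.

Lemma expects_cat s1 s2 G :
  expects (s1 ++ s2) G = expects s1 (fun Ms => expects s2 (fun Ms' => G (Ms ++ Ms'))).
Proof. by elim: s1 G => //= a s1 IH G; apply: eq_expect => M; rewrite IH. Qed.

Lemma eq_expects s G G' :
  (forall Ms, size Ms = size s -> G Ms = G' Ms) -> expects s G = expects s G'.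
Proof.
elim: s G G' => [|a s IH] G G' eqG /=; first exact: eqG.
by apply: eq_expect => M; apply: IH => Ms szMs; apply: eqG; rewrite /= szMs.
Qed.

Lemma mean_cat s1 s2 G c : mean (s1 ++ s2) G c = mean s1 (mean s2 G) c.
Proof.
rewrite /mean expects_cat; apply: eq_expects => Ms _; apply: eq_expects => Ms' _.
by rewrite foldl_cat.
Qed.

Lemma ler_expects s G G' : (forall Ms, G Ms <= G' Ms) -> expects s G <= expects s G'.
Proof.
elim: s G G' => //= a s IH G G' leG.
by apply: ler_expect => [|M]; [apply: chance01 | apply: IH].
Qed.

Lemma expectsD s G G' : expects s (fun Ms => G Ms + G' Ms) = expects s G + expects s G'.
Proof.
elim: s G G' => //= a s IH G G'; rewrite -expectD.
by apply: eq_expect => M; rewrite IH.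
Qed.

Lemma expectsZ s x G : expects s (fun Ms => x * G Ms) = x * expects s G.
Proof.
elim: s G => //= a s IH G; rewrite -expectZ.
by apply: eq_expect => M; rewrite IH.
Qed.

Lemma expects_cst s x : expects s (fun=> x) = x.
Proof. by elim: s => //= a s IH; rewrite IH expect_cst. Qed.

Lemma expects_sum (I : Type) (r : seq I) (P : pred I) s (G : I -> seq {set V} -> rat) :
  expects s (fun Ms => \sum_(i <- r | P i) G i Ms) = \sum_(i <- r | P i) expects s (G i).
Proof.
elim: s G => //= a s IH G; rewrite -expect_sum.
by apply: eq_expect => M; rewrite IH.
Qed.

Definition crowded D v c : rat := ((v \in undec c) && (D < #|nbrs e v :&: active c|)%N)%:R.

(** A node crowded after a slot was crowded before it, and each slot decides a crowded node with
    probability at least a quarter of [D%:R * chance a]. *)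
Lemma mean_crowded D D' a n v c :
  low_degree e D c -> D = D'.*2 -> D%:R * chance a <= 1 / 8 ->
  mean (nseq n a) (crowded D' v) c <= (1 - D%:R * chance a / 4) ^+ n * crowded D' v c.
Proof.
move=> lowD DD' xle; elim: n c lowD => [|n IH] c lowD; first by rewrite mul1r.
have a0 := chance_gt0 a; have x0 : 0 <= D%:R * chance a by rewrite mulr_ge0 // ltW.
set x := D%:R * _ in x0 xle *.
rewrite [nseq _ _]/= mean_cons.
apply: (le_trans (y := expect (chance a) (fun M =>
   (1 - x / 4) ^+ n * crowded D' v (slot_step e c M)))).
  by apply: ler_expect => [|M]; [apply: chance01 | apply: IH; apply: low_degree_step].
rewrite expectZ (exprSr _ n) -[leRHS]mulrA ler_wpM2l ?exprn_ge0 //; first by lra.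
have mono M : crowded D' v (slot_step e c M) <= crowded D' v c.
  rewrite {1}/crowded; case: (boolP (_ && _)) => [/andP[vU' lt]|_]; last exact: ler0n.
  rewrite /crowded (subsetP (undec_step e c M)) //= (leq_trans lt) //.
  by apply: subset_leq_card; apply: setIS; apply: active_step.
have [/andP[vU lt]|nlt] := boolP ((v \in undec c) && (D' < #|nbrs e v :&: active c|)%N).
  rewrite {2}/crowded vU lt mulr1.
  apply: le_trans (expect_stay e_irr (chance01 a) lowD vU DD' lt xle).
  apply: ler_expect => [|M]; first exact: chance01.
  by rewrite /crowded ler_nat; case: (v \in _); case: (_ < _)%N.
have c0 : crowded D' v c = 0 by rewrite /crowded (negbTE nlt).
rewrite c0 mulr0 -(expect_cst V (chance a) 0).
by apply: ler_expect => [|M]; [apply: chance01 | rewrite -c0].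
Qed.

Lemma mean_low_degree D D' a n c :
  low_degree e D c -> D = D'.*2 -> D%:R * chance a <= 1 / 8 ->
  mean (nseq n a) (fun c' => (~~ low_degree e D' c')%:R) c
  <= #|V|%:R * (1 - D%:R * chance a / 4) ^+ n.
Proof.
move=> lowD DD' xle.
apply: (le_trans (y := mean (nseq n a) (fun c' => \sum_v crowded D' v c') c)).
  apply: ler_expects => Ms; set c' := foldl _ _ _.
  have [_|/forallPn[v]] := boolP (low_degree e D' c'); first exact: sumr_ge0.
  rewrite negb_imply -ltnNge => crv.
  by rewrite (bigD1 v) //= {1}/crowded crv lerDl sumr_ge0.
rewrite /mean expects_sum mulr_natl -sumr_const; apply: ler_sum => v _.
apply: le_trans (mean_crowded n v lowD DD' xle) _.
have a0 := chance_gt0 a; have x0 : 0 <= D%:R * chance a by rewrite mulr_ge0 // ltW.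
set x := D%:R * _ in x0 xle *.
rewrite ler_piMr ?exprn_ge0 //; first by lra.
by rewrite /crowded; case: (_ && _).
Qed.

(* Exponential potential for the number of losers around [v]. *)
Definition burden v c : rat := (v \in undec c)%:R * 2 ^+ #|spent_nbrs e c v|.

Lemma burden_ge0 v c : 0 <= burden v c.
Proof. by rewrite mulr_ge0 ?exprn_ge0. Qed.

Lemma mean_burden D a n v c :
  low_degree e D c -> D%:R * chance a <= 1 / 8 ->
  mean (nseq n a) (burden v) c <= (1 + 2 * (D%:R * chance a) ^+ 2) ^+ n * burden v c.
Proof.
move=> lowD xle; elim: n c lowD => [|n IH] c lowD; first by rewrite mul1r.
set x := D%:R * _ in xle IH *; have mu0 : 0 <= 1 + 2 * x ^+ 2.
  by rewrite addr_ge0 // mulr_ge0 // sqr_ge0.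
rewrite [nseq _ _]/= mean_cons.
apply: (le_trans (y := expect (chance a) (fun M =>
   (1 + 2 * x ^+ 2) ^+ n * burden v (slot_step e c M)))).
  by apply: ler_expect => [|M]; [apply: chance01 | apply: IH; apply: low_degree_step].
rewrite expectZ (exprSr _ n) -[leRHS]mulrA ler_wpM2l ?exprn_ge0 //.
have [vU|vU] := boolP (v \in undec c).
  by rewrite {2}/burden vU mul1r; apply: expect_spent => //; apply: chance01.
rewrite {2}/burden (negbTE vU) mul0r mulr0 -(expect_cst V (chance a) 0).
apply: ler_expect => [|M]; first exact: chance01.
rewrite /burden; case: (boolP (v \in undec (slot_step e c M))) => [|_]; last by rewrite mul0r.
by move/(subsetP (undec_step e c M)); rewrite (negbTE vU).
Qed.

(** Active and spent undecided neighbours together are all undecided neighbours, so a run that does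
    not fail leaves degree at most [D + F]. *)
Definition failed D F c :=
  ~~ (low_degree e D c && [forall v in undec c, #|spent_nbrs e c v| <= F]%N).

(* Phase [k] is the one with [k] phases after it: phases are listed with decreasing index. *)
Fixpoint phases (len hz : nat -> nat) m : seq nat :=
  if m is k.+1 then nseq (len k) (hz k) ++ phases len hz k else [::].

(** There are two sources of failure. Some phase may not halve the degree: union bound over phases
    and nodes. Or some node gathers more than [F] losers: Markov's inequality for the exponential
    potential, whose growth is the product over all phases. *)
Lemma mean_failed D F (len hz : nat -> nat) (eps : rat) m c :
  low_degree e (D * 2 ^ m) c -> 0 <= eps ->
  (forall k, (k < m)%N -> (D * 2 ^ k.+1)%:R * chance (hz k) <= 1 / 8 /\
     (1 - (D * 2 ^ k.+1)%:R * chance (hz k) / 4) ^+ len k <= eps) ->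
  mean (phases len hz m) (fun c' => (failed D F c')%:R) c <=
  m%:R * (#|V|%:R * eps) + chance F *
   (\prod_(k < m) (1 + 2 * ((D * 2 ^ k.+1)%:R * chance (hz k)) ^+ 2) ^+ len k) *
     \sum_v burden v c.
Proof.
move=> low0 eps0; elim: m c low0 => [|m IH] c lowD ok.
  rewrite big_ord0 mul0r add0r mulr1 /mean /= /failed.
  rewrite muln1 in lowD; rewrite lowD /=.
  have [_|/forallPn[v]] := boolP [forall v in undec c, #|spent_nbrs e c v| <= F]%N.
    by rewrite mulr_ge0 ?sumr_ge0 ?chance_ge0 // => v _; apply: burden_ge0.
  rewrite negb_imply -ltnNge => /andP[vU lt].
  (* Markov's inequality: more than [F] spent neighbours push the burden above [2 ^+ F]. *)
  apply: (le_trans (y := chance F * burden v c)); last first.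
    apply: ler_wpM2l; first exact: chance_ge0.
    rewrite (bigD1 v) //= lerDl.
    by apply: sumr_ge0 => w _; apply: burden_ge0.
  rewrite /burden vU mul1r -[leLHS](chanceV F) mulrC.
  apply: ler_wpM2l; first exact: chance_ge0.
  by rewrite ler_weXn2l ?ler1n // ltnW.
rewrite [phases _ _ _]/= mean_cat big_ord_recr /=.
set P := \prod_(k < m) _; have [xle decay] := ok _ (ltnSn m).
have lowD' : low_degree e (D * 2 ^ m).*2 c by move: lowD; rewrite expnSr mulnA muln2.
have xE : (D * 2 ^ m.+1)%:R = (D * 2 ^ m).*2%:R :> rat by rewrite expnSr mulnA muln2.
set x := _ * chance _ in xle decay *.
have P0 : 0 <= P.
  by apply: prodr_ge0 => k _; rewrite exprn_ge0 // addr_ge0 // mulr_ge0 // sqr_ge0.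
(* Either the first phase fails to halve the degree, or the induction hypothesis applies to the
   configuration it leaves and is averaged over that phase. *)
apply: (le_trans (y := mean (nseq (len m) (hz m)) (fun c' =>
   (~~ low_degree e (D * 2 ^ m) c')%:R +
   (m%:R * (#|V|%:R * eps) + \sum_v (chance F * P * burden v c'))) c)).
  apply: ler_expects => Ms; set c' := foldl _ _ _.
  have [low|_] := boolP (low_degree e (D * 2 ^ m) c').
    rewrite add0r -mulr_sumr; apply: IH => // k km; apply: ok.
    exact: ltnW.
  apply: (le_trans (y := 1)).
    rewrite -[leRHS](expects_cst (phases len hz m)); apply: ler_expects => Ms'.
    by case: (failed _ _ _).
  rewrite lerDl addr_ge0 ?mulr_ge0 ?sumr_ge0 // => v _.
  by apply: mulr_ge0 (burden_ge0 _ _); apply: mulr_ge0 => //; exact: chance_ge0.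
rewrite /mean !expectsD expects_cst expects_sum.
rewrite -[m.+1%:R]natr1 [(m%:R + 1) * _]mulrDl mul1r.
rewrite [_ + _ * eps]addrC -[leRHS]addrA.
apply: lerD; last first.
  rewrite lerD2l mulr_sumr; apply: ler_sum => v _.
  rewrite expectsZ mulrA -[leRHS]mulrA.
  apply: ler_wpM2l; first by apply: mulr_ge0 => //; exact: chance_ge0.
  by apply: mean_burden => //; rewrite /x xE in xle.
apply: le_trans (mean_low_degree _ lowD' (erefl _) _) _; first by rewrite -xE.
by rewrite -xE ler_wpM2l.
Qed.

End Runs.
(** * The two random runs *)

Section Sparsification.
Variables (V : finType) (e : rel V) (L l : nat).
Hypotheses (e_irr : irreflexive e) (L_gt0 : 0 < L) (cardV : #|V| <= 2 ^ L).
Hypotheses (leLl : L <= 2 ^ l) (lelL : l <= L).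

(** Phase [k] starts with degree bound [2 ^ k.+1], so the exponent [k + 4] keeps [x = D p] at 1/8
    throughout. *)
Definition hazards1 := phases (fun _ => 128 * L) (fun k => k + 4) L.
(** The slot probability is the same in all phases: [x] halves along with the degree bound, while
    the length of the phases doubles. *)
Definition hazards2 := phases (fun k => 128 * L * 2 ^ (l.-1 - k)) (fun _ => 2 * l + 7) l.

Definition start : config V := Config set0 setT set0.
Definition sparse D (c : config V) := [forall v in undec c, #|nbrs e v :&: undec c| <= D].

Local Open Scope ring_scope.

Lemma chance_scale b a : (2 ^ b)%:R * chance (b + a) = chance a.
Proof. by rewrite natrX chanceD mulrA chanceV mul1r. Qed.

(** The base is [1 - chance (j + 5)], so each of the [4 * L] groups of [2 ^ (j + 5)] slots
    contributes a factor at most 1/2. *)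
Lemma phase_decay j : (1 - chance (j + 3) / 4) ^+ (128 * L * 2 ^ j) <= chance (L + 3 * L).
Proof.
have <- : (4 * L = L + 3 * L)%N by lia.
have -> : chance (j + 3) / 4 = chance (j + 5).
  by rewrite !chanceD -mulrA; congr (_ * _).
have -> : (128 * L * 2 ^ j = 2 ^ (j + 5) * (4 * L))%N by rewrite expnD; lia.
rewrite exprM ler_pXn2r ?nnegrE ?invr_ge0 ?exprn_ge0 ?subr_ge0 //.
- apply: le_trans (exp_decay (chance01 _) _) _; first by rewrite natrX chanceV.
  by rewrite mul1r; exact: lexx.
- by rewrite muln_gt0.
by have /andP[] := chance01 (j + 5).
Qed.

Lemma chance_le j k : (j <= k)%N -> chance k <= chance j.
Proof.
move=> jk; rewrite -(subnKC jk) chanceD ler_piMr //; first exact: chance_ge0.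
by have /andP[] := chance01 (k - j).
Qed.

(** The excess of factor [j] over 1 is about [chance j / 32], which is summable; subtracting
    [chance m] from 2 lets the induction close. *)
Lemma prod_growth m :
  \prod_(j < m) (1 + 2 * chance (j + 3) ^+ 2) ^+ (2 ^ j) <= 2 - chance m.
Proof.
elim: m => [|m IH]; first by rewrite big_ord0 /chance expr0; lra.
rewrite big_ord_recr /=; set P := \prod_(j < m) _ in IH *.
have t0 := chance_gt0 m; have /andP[_ t1] := chance01 m.
set t := chance m in t0 t1 IH *.
have yE : (2 ^ m)%:R * (2 * chance (m + 3) ^+ 2) = t / 32.
  have -> : 2 * chance (m + 3) ^+ 2 = chance (m + (m + 5)).
    rewrite expr2 !chanceD -/t; have -> : chance 3 = 1 / 8 by [].
    by have -> : chance 5 = 1 / 32 by []; field.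
  by rewrite chance_scale chanceD.
have y0 : 0 <= 2 * chance (m + 3) ^+ 2 by rewrite mulr_ge0 // sqr_ge0.
have := exp_quadratic (d := (2 ^ m)%N) y0; rewrite yE => /(_ ltac:(lra)).
set Q := (1 + _) ^+ _ => Qle.
have -> : chance m.+1 = t / 2 by rewrite -addn1 chanceD.
have Q0 : 0 <= Q by rewrite exprn_ge0 // addr_ge0.
apply: (le_trans (y := (2 - t) * Q)); first by rewrite ler_wpM2r.
apply: (le_trans (y := (2 - t) * (1 + t / 32 + (t / 32) ^+ 2))).
  by rewrite ler_wpM2l //; lra.
have : 0 <= t * (1 - t) by rewrite mulr_ge0 ?subr_ge0 // ltW.
have : 0 <= t * t * t by rewrite !mulr_ge0 // ltW.
by rewrite expr2; nra.
Qed.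

Lemma exp2_bound (x : rat) n : 0 <= x -> x <= 2 -> x ^+ n <= 2 ^+ n.
Proof. by move=> x0 x2; rewrite lerXn2r ?nnegrE. Qed.

Lemma sum_burden c : spent c = set0 -> \sum_v burden e v c <= 2 ^+ L.
Proof.
move=> sp0; apply: (le_trans (y := \sum_(v : V) 1)).
  apply: ler_sum => v _; rewrite /burden /spent_nbrs sp0 setI0 cards0 mulr1.
  by case: (_ \in _).
by rewrite sumr_const -natrX ler_nat.
Qed.

Lemma card_chance m : #|V|%:R * chance (L + m) <= chance m.
Proof.
rewrite -[leRHS](chance_scale L m); apply: ler_wpM2r; first exact: chance_ge0.
by rewrite ler_nat.
Qed.

(** The threshold [w + (L + m)] absorbs the growth [2 ^+ w] and the total initial burden
    [2 ^+ L]. *)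
Lemma burden_tail w m (x : rat) c : spent c = set0 -> 0 <= x -> x <= 2 ->
  chance (w + (L + m)) * x ^+ w * \sum_v burden e v c <= chance m.
Proof.
move=> sp0 x0 x2; rewrite -[leRHS](chance_scale L m) natrX [leRHS]mulrC.
have b0 : 0 <= \sum_v burden e v c by apply: sumr_ge0 => v _; apply: burden_ge0.
apply: ler_pM => //; last exact: sum_burden.
  by apply: mulr_ge0; [apply: chance_ge0 | apply: exprn_ge0].
rewrite chanceD mulrAC -[leRHS]mul1r; apply: ler_wpM2r; first exact: chance_ge0.
rewrite -(chanceV w) mulrC; apply: ler_wpM2r; first exact: chance_ge0.
exact: exp2_bound.
Qed.

Lemma mean_failed1 :
  mean e hazards1 (fun c => (failed e 1 (8 * L * L + (L + 3 * L)) c)%:R) start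
  <= (L%:R + 1) * chance (3 * L).
Proof.
have xE k : (1 * 2 ^ k.+1)%:R * chance (k + 4) = chance (0 + 3).
  have -> : (k + 4 = k.+1 + (0 + 3))%N by lia.
  by rewrite mul1n chance_scale.
apply: le_trans (mean_failed (eps := chance (L + 3 * L)) e_irr _ _ _ _) _.
- apply/'forall_implyP => v _; rewrite mul1n; apply: leq_trans cardV.
  exact: max_card.
- exact: chance_ge0.
- move=> k _; rewrite xE; split; first exact: lexx.
  by rewrite -[(128 * L)%N]muln1; apply: (phase_decay 0).
have [y yE] : {y : rat | y = 2 * chance (0 + 3) ^+ 2} by exists (2 * chance (0 + 3) ^+ 2).
have y32 : y = 1 / 32 by rewrite yE.
(* The growth over all [128 * L * L] slots is therefore at most [2 ^+ (8 * L * L)], whence the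
   threshold. *)
have X2 : (1 + y) ^+ 16 <= 2.
  by have := exp_quadratic (p := y) (d := 16); rewrite y32; lra.
have X0 : 0 <= (1 + y) ^+ 16 by apply: exprn_ge0; lra.
rewrite (eq_bigr (fun=> (1 + y) ^+ (128 * L))); last by move=> k _; rewrite xE yE.
rewrite prodr_const card_ord -exprM mulrDl mul1r.
apply: lerD; first by apply: ler_wpM2l; [apply: ler0n | apply: card_chance].
have -> : (128 * L * L = 16 * (8 * L * L))%N by lia.
by rewrite exprM; apply: burden_tail.
Qed.

Lemma mean_failed2 c : low_degree e (2 ^ (4 + 2 * l)) c -> spent c = set0 ->
  mean e hazards2 (fun c => (failed e (2 ^ (4 + l)) (128 * L + (L + 3 * L)) c)%:R) c
  <= (L%:R + 1) * chance (3 * L).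
Proof.
move=> lowc sp0.
have xE k : (k < l)%N ->
    (2 ^ (4 + l) * 2 ^ k.+1)%:R * chance (2 * l + 7) = chance ((l.-1 - k) + 3).
  move=> kl; rewrite -expnD (_ : 2 * l + 7 = (4 + l + k.+1) + ((l.-1 - k) + 3))%N; last by lia.
  by rewrite chance_scale.
apply: le_trans (mean_failed (eps := chance (L + 3 * L)) e_irr _ _ _ _) _.
- by rewrite -expnD; have -> : (4 + l + l = 4 + 2 * l)%N by lia.
- exact: chance_ge0.
- move=> k kl; rewrite xE //; split; last exact: phase_decay.
  have -> : 1 / 8 = chance 3 by [].
  by apply: chance_le; apply: leq_addl.
(* The slots are grouped so that the growth is the power [128 * L] of the product in [prod_growth],
   read in reverse order. *)
rewrite (eq_bigr (fun k : 'I_l =>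
   ((1 + 2 * chance ((l.-1 - k) + 3) ^+ 2) ^+ (2 ^ (l.-1 - k))) ^+ (128 * L))); last first.
  by move=> k _; rewrite xE // -exprM [in RHS]mulnC.
rewrite prodrXl (reindex_inj rev_ord_inj) /=.
rewrite (eq_bigr (fun j : 'I_l => (1 + 2 * chance (j + 3) ^+ 2) ^+ (2 ^ j))); last first.
  move=> j _; have -> : (l.-1 - (l - j.+1) = j)%N by have := ltn_ord j; lia.
  by [].
set X := \prod_(j < l) _.
have X0 : 0 <= X.
  by apply: prodr_ge0 => j _; rewrite exprn_ge0 // addr_ge0 // mulr_ge0 // sqr_ge0.
have X2 : X <= 2 by have := prod_growth l; have := chance_gt0 l; rewrite -/X; lra.
rewrite mulrDl mul1r; apply: lerD; last exact: burden_tail.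
apply: ler_pM; [exact: ler0n | | by rewrite ler_nat | exact: card_chance].
by apply: mulr_ge0; [apply: ler0n | apply: chance_ge0].
Qed.

Lemma not_failed_degree D F c v : ~~ failed e D F c -> v \in undec c ->
  (#|nbrs e v :&: undec c| <= D + F)%N.
Proof.
move=> /negbNE/andP[/'forall_implyP lowD /'forall_implyP lowF] vU.
apply: leq_trans (leq_add (lowD v vU) (lowF v vU)); apply: leq_trans (leq_card_setU _ _).
apply: subset_leq_card; apply/subsetP => u; rewrite !inE => /andP[-> ->] /=.
by case: (u \in spent c).
Qed.

(** The first run leaves at most [1 + 8 L ^ 2 + 4 L <= 2 ^ (4 + 2 * l)] undecided neighbours, where
    the second starts; that one leaves at most [2 ^ (4 + l) + 132 L <= 2 ^ (8 + l)]. The two failure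
    probabilities add up to at most [2 (L + 1) chance (3 L) <= chance L]. *)
Lemma mean_not_sparse :
  mean e hazards1 (fun c => mean e hazards2
    (fun c' => (~~ sparse (2 ^ (8 + l)) c')%:R) (refresh c)) start <= chance L.
Proof.
pose b : rat := (L%:R + 1) * chance (3 * L).
have b0 : 0 <= b by apply: mulr_ge0 (chance_ge0 _); apply: addr_ge0.
apply: (le_trans (y := b + b)); last first.
  rewrite /b natr1 -mulrDl -natrD (_ : 3 * L = 2 * L + L)%N; last by lia.
  rewrite chanceD mulrA ler_piMl ?chance_ge0 //.
  rewrite -[leRHS](chanceV (2 * L)) ler_wpM2r ?chance_ge0 // -natrX ler_nat.
  rewrite mul2n -addnn expnD; have := ltn_expl L (ltnSn 1).
  by move: (2 ^ L)%N => z Lz; have : (L.+1 * L.+1 <= z * z)%N by [apply: leq_mul]; nia.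
apply: (le_trans (y := mean e hazards1
    (fun c => (failed e 1 (8 * L * L + (L + 3 * L)) c)%:R + b) start)); last first.
  by rewrite /mean expectsD expects_cst lerD2r; apply: mean_failed1.
apply: ler_expects => Ms; set c := foldl _ _ _.
have [_|ok] := boolP (failed e _ _ c).
  apply: (le_trans (y := 1)); last by rewrite lerDl.
  rewrite -[leRHS](expects_cst V hazards2); apply: ler_expects => Ms'.
  by case: (sparse _ _).
rewrite add0r; apply: le_trans (mean_failed2 (c := refresh c) _ _) => //.
  apply: ler_expects => Ms'; set c' := foldl _ _ _.
  have [_|ok'] := boolP (failed e _ _ c'); first by case: (sparse _ _).
  suff -> : sparse (2 ^ (8 + l)) c' by [].
  apply/'forall_implyP => v vU; apply: leq_trans (not_failed_degree ok' vU) _.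
  by rewrite !expnD; move: (2 ^ l)%N leLl => z; lia.
apply/'forall_implyP => v vU; rewrite /active /= setD0.
apply: leq_trans (not_failed_degree ok vU) _.
rewrite expnD mul2n -addnn expnD; move: (2 ^ l)%N leLl => z Lz.
have : (L * L <= z * z)%N by apply: leq_mul.
by have : (L <= L * L)%N by [rewrite leq_pmulr]; lia.
Qed.

End Sparsification.
(** * From random bits to random subsets *)

Section RandomBits.
Variable V : finType.
Implicit Types (w a : nat) (hz : seq nat) (bits : seq bool).

(* Slot [t] uses the block of [w] bits starting at [t * w]. *)
Definition marked hz w bits t :=
  (t < size hz) && all id (take (nth 0 hz t) (drop (t * w) bits)).

Definition marks hz w (f : V -> seq bool) t := [set v | marked hz w (f v) t].

(** Joins a first block and the remaining bits of every node; its bijectivity expresses the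
    independence of the blocks. *)
Definition cat_pair m n (gh : {ffun V -> m.-tuple bool} * {ffun V -> n.-tuple bool}) :
  {ffun V -> (m + n).-tuple bool} := [ffun v => [tuple of gh.1 v ++ gh.2 v]].

Lemma cat_pair_bij m n : bijective (@cat_pair m n).
Proof.
apply: inj_card_bij; last first.
  by rewrite card_prod !card_ffun !card_tuple card_bool -expnMn -expnD.
move=> [g h] [g' h'] /ffunP eqf; congr pair; apply/ffunP => v;
  have := congr1 val (eqf v); rewrite !ffunE /= => /eqP;
  by rewrite eqseq_cat ?size_tuple // => /andP[/eqP ? /eqP ?]; apply/val_inj.
Qed.

Lemma card_all_take a b :
  #|[set t : (a + b).-tuple bool | all id (take a t)]| = 2 ^ b.
Proof.
pose f (u : b.-tuple bool) := [tuple of nseq_tuple a true ++ u].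
have f_inj : injective f.
  move=> u u' /(congr1 val) /= /eqP; rewrite eqseq_cat // => /andP[_ /eqP].
  by move/val_inj.
rewrite -card_bool -card_tuple -(card_imset _ f_inj).
apply: eq_card => t; rewrite inE; apply/idP/imsetP => [allt|[u _ ->]]; last first.
  by rewrite /= take_size_cat ?size_nseq // all_nseq orbT.
have sz : size (drop a t) == b by rewrite size_drop size_tuple addKn.
exists (Tuple sz); rewrite ?inE //; apply/val_inj; rewrite /= -{1}(cat_take_drop a t).
congr (_ ++ _); have sz' : size (take a t) = a.
  by rewrite size_takel // size_tuple leq_addr.
have /all_pred1P -> : all (pred1 true) (take a t) by apply: sub_all allt; case.
by rewrite sz'.
Qed.

Local Open Scope ring_scope.

(** Assignments are grouped by the set they define; the number that defines a given set is a product
    over the nodes, proportional to [weight]. *)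
Lemma sum_marked_block w a (H : {set V} -> rat) : (a <= w)%N ->
  \sum_(g : {ffun V -> w.-tuple bool}) H [set v | all id (take a (g v))]
  = #|{ffun V -> w.-tuple bool}|%:R * expect (chance a) H.
Proof.
move=> /subnKC <-; set b := (w - a)%N.
rewrite (eq_bigr (fun g : {ffun V -> (a + b).-tuple bool} =>
   \sum_(M : {set V}) H M * ([set v | all id (take a (g v))] == M)%:R)); last first.
  move=> g _; rewrite (bigD1 [set v | all id (take a (g v))]) //= eqxx mulr1.
  by rewrite big1 ?addr0 // => M /negbTE; rewrite eq_sym => ->; rewrite mulr0.
rewrite exchange_big /= /expect mulr_sumr; apply: eq_bigr => M _.
rewrite -mulr_sumr [RHS]mulrA mulrC; congr (_ * _).
rewrite (eq_bigr (fun g : {ffun V -> (a + b).-tuple bool} =>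
   \prod_v (all id (take a (g v)) == (v \in M))%:R)); last first.
  move=> g _; case: eqP => [<-|neq].
    by rewrite big1 // => v _; rewrite inE eqxx.
  have [v vM] : exists v, (all id (take a (g v)) != (v \in M)).
    apply/existsP; rewrite -negb_forall; apply/negP => /forallP eqM; case: neq.
    by apply/setP => v; rewrite inE (eqP (eqM v)).
  by rewrite (bigD1 v) //= (negbTE vM) mul0r.
rewrite -(bigA_distr_bigA (fun v (t : (a + b).-tuple bool) =>
   (all id (take a t) == (v \in M))%:R)).
rewrite card_ffun natrX -prodr_const -big_split; apply: eq_bigr => v _ /=.
have cnt : \sum_(t : (a + b).-tuple bool) (all id (take a t))%:R = (2 ^ b)%:R :> rat.
  rewrite -(card_all_take a b) -sum1_card natr_sum [RHS]big_mkcond.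
  by apply: eq_bigr => t _; rewrite inE; case: ifP.
have tot : (2 ^ b)%:R = #|{: (a + b).-tuple bool}|%:R * chance a :> rat.
  by rewrite card_tuple card_bool addnC expnD natrM -mulrA [in X in _ * X]natrX chanceV mulr1.
case: (v \in M).
  by rewrite -tot -cnt; apply: eq_bigr => t _; case: (all _ _).
rewrite mulrBr mulr1 -tot -cnt -sum1_card natr_sum -sumrB; apply: eq_bigr => t _.
by case: (all _ _).
Qed.

(** Transfers the probabilistic estimates to counts of bit assignments; the induction splits off the
    first block. *)
Lemma sum_marks hz w (G : seq {set V} -> rat) : all (fun a => a <= w)%N hz ->
  \sum_(f : {ffun V -> (size hz * w).-tuple bool})
    G [seq marks hz w (fun v => tval (f v)) t | t <- iota 0 (size hz)]
  = #|{ffun V -> (size hz * w).-tuple bool}|%:R * expects hz G.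
Proof.
elim: hz G => [|a hz IH] G /=.
  move=> _; rewrite big_const iter_addr_0 -[LHS]mulr_natl.
  by congr (_ * _); congr (_%:R); apply: eq_card.
case/andP => aw ok; rewrite (reindex (@cat_pair w (size hz * w))) /=; last first.
  exact/onW_bij/cat_pair_bij.
rewrite -(pair_bigA _ (fun g h => G (marks (a :: hz) w (fun v => tval (cat_pair (g, h) v)) 0 ::
  [seq marks (a :: hz) w (fun v => tval (cat_pair (g, h) v)) t | t <- iota 1 (size hz)]))) /=.
rewrite (eq_bigr (fun g : {ffun V -> w.-tuple bool} =>
   #|{ffun V -> (size hz * w).-tuple bool}|%:R *
   expects hz (fun Ms => G ([set v | all id (take a (g v))] :: Ms)))); last first.
  move=> g _; rewrite -IH //; apply: eq_bigr => h _; congr (G (_ :: _)).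
    apply/setP => v; rewrite !inE /marked /= mul0n drop0 ffunE /=.
    by rewrite takel_cat ?size_tuple.
  rewrite (iotaDl 1 0) -map_comp; apply: eq_map => t /=.
  apply/setP => v; rewrite !inE /marked add1n /= ltnS ffunE /=.
  by rewrite mulSn [(w + _)%N]addnC -drop_drop drop_size_cat ?size_tuple.
rewrite -mulr_sumr (sum_marked_block (fun M => expects hz (fun Ms => G (M :: Ms)))) //.
rewrite mulrA -natrM; congr (_%:R * _).
by rewrite -(bij_eq_card (cat_pair_bij w (size hz * w))) card_prod mulnC.
Qed.

End RandomBits.
(** * Linial's colour reduction *)

Section ColourReduction.
Variables h k : nat.

Fact binary_field_exists : {F : finFieldType | #|F| = 2 ^ h.+1}.
Proof. by case: (pPrimePowerField (isT : prime 2) (ltn0Sn h)) => F _ cardF; exists F. Qed.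

Definition binary_field : finFieldType := sval binary_field_exists.

Lemma card_binary_field : #|binary_field| = 2 ^ h.+1.
Proof. exact: svalP binary_field_exists. Qed.

Local Open Scope ring_scope.

(** Colours below [q ^ k] stand for the polynomials of degree below [k] over the field with
    [q = 2 ^ h.+1] elements. *)
Definition colour_coefs (c : nat) : k.-tuple binary_field :=
  nth [tuple of nseq k 0] (enum {: k.-tuple binary_field}) c.

Definition colour_value (c : nat) (x : binary_field) := (Poly (colour_coefs c)).[x].

Lemma colour_value_collisions (c c' : nat) :
  (c < (2 ^ h.+1) ^ k)%N -> (c' < (2 ^ h.+1) ^ k)%N -> c != c' ->
  (#|[set x | colour_value c x == colour_value c' x]| <= k.-1)%N.
Proof.
move=> cq c'q neq; set p := Poly (colour_coefs c); set p' := Poly (colour_coefs c').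
have sz q : (size (Poly (colour_coefs q)) <= k)%N.
  by apply: leq_trans (size_Poly _) _; rewrite size_tuple.
have szE : size (enum {: k.-tuple binary_field}) = ((2 ^ h.+1) ^ k)%N.
  by rewrite -cardE card_tuple card_binary_field.
have pp' : p - p' != 0.
  rewrite subr_eq0; apply: contra neq => /eqP eqp.
  rewrite -(nth_uniq [tuple of nseq k 0] _ _ (enum_uniq {: k.-tuple binary_field})) ?szE //.
  apply/eqP; rewrite -/(colour_coefs c) -/(colour_coefs c'); apply/val_inj.
  move: (colour_coefs c) (colour_coefs c') @p @p' eqp => t t' /= eqp.
  apply: (@eq_from_nth _ 0); first by rewrite !size_tuple.
  by move=> i _; rewrite -coef_Poly eqp coef_Poly.
have := max_poly_roots pp' _ (enum_uniq [set x | colour_value c x == colour_value c' x]).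
rewrite -cardE => lt; have {lt} : (#|[set x | colour_value c x == colour_value c' x]| < k)%N.
  apply: leq_trans (lt _) _.
    apply/allP => x; rewrite mem_enum inE rootE hornerD hornerN subr_eq0.
    by rewrite /colour_value.
  apply: leq_trans (size_polyD _ _) _.
  by rewrite size_polyN geq_max !sz.
by case: k.
Qed.

Local Close Scope ring_scope.

Definition separates (c : nat) (cs : seq nat) (x : binary_field) :=
  all (fun c' => colour_value c x != colour_value c' x) cs.

(** The new colour encodes a separating point together with the value there; the default 0 is used
    only when no point separates. *)
Definition recolour (c : nat) (cs : seq nat) : nat :=
  let x := odflt 0%R [pick x | separates c cs x] in
  enum_rank x * 2 ^ h.+1 + enum_rank (colour_value c x).

Lemma enum_rank_lt (x : binary_field) : enum_rank x < 2 ^ h.+1.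
Proof. by rewrite -card_binary_field. Qed.

Lemma recolour_lt c cs : recolour c cs < 2 ^ h.+1 * 2 ^ h.+1.
Proof.
rewrite /recolour; set x := odflt _ _; apply: (@leq_trans ((enum_rank x).+1 * 2 ^ h.+1)).
  by rewrite mulSnr ltn_add2l enum_rank_lt.
by rewrite leq_mul2r enum_rank_lt orbT.
Qed.

(* Polynomials of degree below [k] agree in fewer than [k] points, so some point
   separates [c] from all of [cs]. *)
Lemma recolour_proper c cs c' cs' :
  c < (2 ^ h.+1) ^ k ->
  (forall c'', c'' \in cs -> c'' != c /\ c'' < (2 ^ h.+1) ^ k) ->
  size cs * k.-1 < 2 ^ h.+1 -> c' \in cs -> recolour c cs != recolour c' cs'.
Proof.
move=> cq csq few c'cs; rewrite /recolour; set y := odflt _ [pick x | separates c' _ _].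
have [x sepx ->] : exists2 x, separates c cs x &
    odflt 0%R [pick x | separates c cs x] = x.
  case: pickP => [x sepx|none] /=; first by exists x.
  (* Otherwise every point of the field is a collision with some colour in [cs], but there are at
     most [size cs * k.-1] collisions. *)
  move: few; rewrite ltnNge -card_binary_field => /negP[].
  rewrite -sum1_card; apply: (@leq_trans (\sum_(x : binary_field)
     \sum_(c'' <- cs) (colour_value c x == colour_value c'' x))).
    apply: leq_sum => x _; have := none x; rewrite /separates => /negbT.
    rewrite -has_predC => /hasP[c'' c''cs /negPn /= eqv].
    by rewrite (big_rem c'') //= eqv.
  rewrite exchange_big /= -sum1_size big_distrl /=.
  rewrite big_seq [leqRHS]big_seq; apply: leq_sum => c'' /csq[neq c''q].
  rewrite mul1n; apply: leq_trans (colour_value_collisions cq c''q _); last by rewrite eq_sym.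
  by rewrite -sum1_card [leqRHS]big_mkcond; apply: leq_sum => x _; rewrite inE; case: eqP.
(* Equal new colours have the same point and the same value there, yet this point separates [c] from
   [c']. *)
apply/negP => /eqP eqr; have q0 : 0 < 2 ^ h.+1 by rewrite expn_gt0.
have /val_inj/enum_rank_inj xy : val (enum_rank x) = val (enum_rank y).
  have := congr1 (divn^~ (2 ^ h.+1)) eqr.
  by rewrite !divnMDl // !divn_small ?enum_rank_lt // !addn0.
move: eqr; rewrite -xy => /addnI /val_inj/enum_rank_inj eqv.
by move/allP: sepx => /(_ _ c'cs); rewrite eqv eqxx.
Qed.

End ColourReduction.
(** * Wake-up schedule *)

Section Rendezvous.

(** At each scale [j < J]: the last multiple of [2 ^ j] up to [t] and the first one beyond it. *)
Definition rendezvous J t :=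
  [seq t %/ 2 ^ j * 2 ^ j | j <- iota 0 J] ++ [seq (t %/ 2 ^ j).+1 * 2 ^ j | j <- iota 0 J].

Lemma size_rendezvous J t : size (rendezvous J t) = 2 * J.
Proof. by rewrite size_cat !size_map size_iota mul2n addnn. Qed.

Lemma mem_rendezvous J t : 0 < J -> t \in rendezvous J t.
Proof.
case: J => // J _; rewrite mem_cat; apply/orP; left.
by apply/mapP; exists 0; rewrite ?mem_iota // divn1 muln1.
Qed.

(* Cut at the highest binary digit where [s] and [t] differ. *)
Lemma rendezvous_common J s t : s < t -> t < 2 ^ J ->
  exists u, [/\ s < u, u <= t, u \in rendezvous J s & u \in rendezvous J t].
Proof.
move=> st tJ; pose P j := s %/ 2 ^ j == t %/ 2 ^ j.
have PJ : P J by rewrite /P !divn_small // (ltn_trans st).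
case: (ex_minnP (ex_intro _ J PJ)) => -[|j]; rewrite /P.
  by rewrite !divn1 => /eqP eqst; rewrite eqst ltnn in st.
rewrite expnSr !divnMA => /eqP half min.
have jJ : j < J by apply: min.
have neq : s %/ 2 ^ j != t %/ 2 ^ j by apply/negP => /min; rewrite ltnn.
(* Both lie in one dyadic cell at scale [j.+1], hence in its two halves at scale [j]; they meet at
   the border of the halves. *)
have tE : t %/ 2 ^ j = (s %/ 2 ^ j).+1.
  by have := leq_div2r (2 ^ j) (ltnW st); lia.
have p0 : 0 < 2 ^ j by rewrite expn_gt0.
exists ((t %/ 2 ^ j) * 2 ^ j); split.
- by rewrite tE; apply: ltn_ceil.
- exact: leq_trunc_div.
- rewrite mem_cat; apply/orP; right; apply/mapP.
  by exists j; rewrite ?tE // mem_iota.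
- rewrite mem_cat; apply/orP; left; apply/mapP.
  by exists j; rewrite // mem_iota.
Qed.

End Rendezvous.

(** * The idealized slot process and its invariants *)

Section Process.
Variables (V : finType) (e : rel V).
Hypotheses (e_sym : symmetric e) (e_irr : irreflexive e).
Variables (mk : nat -> {set V}) (rs : pred nat).
Implicit Types (c : config V) (M : {set V}).

Definition refresh_if b c := if b then refresh c else c.

(** [mk t] holds the nodes marked for slot [t]; [rs] holds when a new run starts and the slots taken
    so far are forgotten. *)
Fixpoint process t : config V :=
  if t is t'.+1 then slot_step e (refresh_if (rs t') (process t')) (mk t') else start V.

Definition before t := refresh_if (rs t) (process t).

Lemma joined_before t : joined (before t) = joined (process t).
Proof. by rewrite /before /refresh_if; case: ifP. Qed.

Lemma undec_before t : undec (before t) = undec (process t).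
Proof. by rewrite /before /refresh_if; case: ifP. Qed.

Definition consistent c :=
  [/\ forall u v, u \in joined c -> v \in joined c -> ~~ e u v,
      forall u v, u \in joined c -> v \in undec c -> (u != v) && ~~ e u v
    & forall v, [|| v \in joined c, v \in undec c | [exists u in joined c, e v u]]].

Lemma consistent_step c M : consistent c -> consistent (slot_step e c M).
Proof.
case=> indep sep cover.
have winU u : u \in winners e c M -> u \in undec c.
  by rewrite !inE => /andP[/andP[/andP[_ ->]]].
split.
- move=> u v; rewrite /= in_setU => /orP[ju|wu]; rewrite in_setU => /orP[jv|wv].
  + exact: indep.
  + by case/andP: (sep u v ju (winU _ wv)).
  + by rewrite e_sym; case/andP: (sep v u jv (winU _ wu)).
  move: wu wv; rewrite inE => /andP[_ /'forall_implyP nob].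
  by rewrite inE => /andP[vC _]; apply: nob.
- move=> u v; rewrite /= in_setU => /orP[ju|wu]; rewrite in_setD in_setU negb_or.
    by case/andP=> _; apply: sep.
  case/andP=> /andP[vw vn] _; apply/andP; split.
    by apply: contra vw => /eqP <-.
  apply: contra vn => euv; rewrite inE; apply/existsP; exists u.
  by rewrite wu e_sym.
move=> v; rewrite /= !in_setU in_setD in_setU.
have sub : [exists u in joined c, e v u] -> [exists u in joined c :|: winners e c M, e v u].
  case/'exists_andP => u [ju evu]; apply/existsP; exists u.
  by rewrite in_setU ju.
case/or3P: (cover v) => [->//|vU|/sub ->]; last by rewrite !orbT.
rewrite vU andbT negb_or; case: (v \in winners e c M) => /=; first by rewrite orbT.
rewrite orbF; case: (v \in joined c) => //=.
rewrite inE; case: existsP => //= -[u /andP[wu evu]].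
by apply/existsP; exists u; rewrite in_setU wu orbT.
Qed.

Lemma consistent_process t : consistent (process t).
Proof.
elim: t => [|t IH].
  by split=> [u v|u v|v]; rewrite !inE ?orbT.
by apply: consistent_step; rewrite /refresh_if; case: ifP.
Qed.

Lemma joinedS t : joined (process t.+1) = joined (process t) :|: winners e (before t) (mk t).
Proof. by rewrite /= -[refresh_if _ _]/(before t) joined_before. Qed.

Lemma joined_mono s t : s <= t -> joined (process s) \subset joined (process t).
Proof.
move/subnKC <-; elim: (t - s) => [|m IH]; first by rewrite addn0.
by rewrite addnS joinedS; apply: subset_trans IH (subsetUl _ _).
Qed.

Lemma undec_mono s t : s <= t -> undec (process t) \subset undec (process s).
Proof.
move/subnKC <-; elim: (t - s) => [|m IH]; first by rewrite addn0.
rewrite addnS; apply: subset_trans IH; rewrite -(undec_before (s + m)).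
exact: undec_step.
Qed.

Lemma joined_at t v : v \in joined (process t) ->
  exists s, [/\ s < t, v \in winners e (before s) (mk s) & v \in joined (process s.+1)].
Proof.
elim: t => [|t IH]; first by rewrite inE.
rewrite joinedS in_setU => /orP[/IH[s [st ws js]]|wt].
  by exists s; split=> //; apply: ltnW.
by exists t; split=> //; rewrite joinedS in_setU wt orbT.
Qed.

Lemma spent_before t v :
  (v \in spent (before t)) = has (fun s => (v \in mk s) && ~~ has rs (iota s.+1 (t - s))) (iota 0 t).
Proof.
have iotaE a m : iota a m.+1 = iota a m ++ [:: a + m] by rewrite -addn1 iotaD.
elim: t => [|t IH].
  by rewrite /before /refresh_if /=; case: ifP; rewrite inE.
have eqh s : s < t -> ~~ has rs (iota s.+1 (t.+1 - s)) = ~~ rs t.+1 && ~~ has rs (iota s.+1 (t - s)).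
  move=> st; rewrite subSn ?(ltnW st) // iotaE has_cat negb_or /= orbF andbC.
  by rewrite addSn subnKC // ltnW.
rewrite iotaE has_cat /= orbF add0n subSnn /= orbF.
rewrite {1}/before /refresh_if; case: ifP => rst.
  rewrite inE; symmetry; apply/negbTE; rewrite andbF orbF; apply/hasPn => s.
  by rewrite mem_iota => /= st; rewrite eqh // rst andbF.
rewrite andbT [spent _]/(spent (before t) :|: mk t) in_setU IH; congr (_ || _).
by apply: eq_in_has => s; rewrite mem_iota => /= st; rewrite eqh // rst.
Qed.

End Process.
(** * The distributed algorithm *)

Section Messages.
Variables (A : algo) (n : nat) (e : rel 'I_n) (id : 'I_n -> nat) (c : 'I_n -> St A).
Variables (r : nat) (v : 'I_n).

Definition speakers :=
  [set u | [&& e v u, is_awake A (c u) r & send A (c u) r (id v) != None]].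

Lemma mem_received x :
  reflect (exists u, [/\ e v u, is_awake A (c u) r, send A (c u) r (id v) = Some x.2
                       & id u = x.1])
          (x \in received A e id c r v).
Proof.
rewrite /received mem_sort; apply: (iffP idP).
  rewrite mem_pmap => /mapP[u _]; case: ifP => // /andP[evu aw].
  by case E: (send _ _ _ _) => [m|] //= [->]; exists u.
case=> u [evu aw sm idu]; rewrite mem_pmap; apply/mapP; exists u; first by rewrite mem_enum.
by rewrite evu aw sm /= idu; case: x {sm idu}.
Qed.

Lemma size_received : size (received A e id c r v) = #|speakers|.
Proof.
rewrite /received size_sort size_pmap cardE [in RHS]/enum_mem size_filter [in LHS]enumT.
apply: eq_count => u /=; rewrite inE; case: (e v u) => //=; case: (is_awake _ _ _) => //=.
by case: (send _ _ _ _).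
Qed.

Lemma received_nil : (received A e id c r v == [::]) = (speakers == set0).
Proof. by rewrite -size_eq0 size_received cards_eq0. Qed.

End Messages.

(** * Parameters and local program of the nodes *)

Section Algorithm.
Implicit Types (N r t : nat) (bits : seq bool) (ss : seq nat).

Definition logb N := (up_log 2 N).+1.
Definition loglogb N := up_log 2 (logb N).
Definition hazards N := hazards1 (logb N) ++ hazards2 (logb N) (loglogb N).
Definition second_run N := size (hazards1 (logb N)).
Definition sync N := size (hazards N).
Definition block N := logb N + 2 * loglogb N + 16.
(** Two units for the colouring exchanges, then one slot for each colour the second reduction can
    produce. *)
Definition last_slot N := sync N + 2 + 2 ^ (10 + loglogb N) * 2 ^ (10 + loglogb N).
Definition levels N := up_log 2 (last_slot N).

#[global] Arguments logb N : simpl never.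
#[global] Arguments sync N : simpl never.
#[global] Arguments second_run N : simpl never.
#[global] Arguments last_slot N : simpl never.

Definition first_mark N bits t m :=
  take 1 [seq x <- iota t m | marked (hazards N) (block N) bits x].

Definition early_slots N bits :=
  first_mark N bits 0 (second_run N) ++
  first_mark N bits (second_run N) (sync N - second_run N).

Record node := Node {
  clock : nat; bound : nat; name : nat; colour : nat; slots : seq nat; status : option bool }.

(* Time unit [t] consists of rounds [2t] (members of the set announce themselves)
   and [2t+1] (slot [t], or one of the two colouring exchanges). *)
Definition units N ss := [:: sync N, (sync N).+1 & flatten (map (rendezvous (levels N)) ss)].

Definition node_wake (s : node) : option nat :=
  ohead [seq r <- iota (clock s) ((last_slot (bound s)).*2 - clock s)
           | r./2 \in units (bound s) (slots s)].

Definition node_send (s : node) r (_ : nat) : option nat :=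
  if ~~ odd r then (if status s == Some true then Some 0 else None)
  else if status s != None then None
  else if r./2 == sync (bound s) then Some 0
  else if r./2 == (sync (bound s)).+1 then Some (colour s)
  else if r./2 \in slots s then Some 0 else None.

(** In an even round any message comes from a neighbour in the set; at an own slot silence means no
    collision. The first reduction uses the senders' identifiers as colours, the second the colours
    they send. *)
Definition node_step (s : node) r (msgs : seq (nat * nat)) : node :=
  let: Node _ N v k ss st := s in
  if ~~ odd r then
    Node r.+1 N v k ss (if (st == None) && (msgs != [::]) then Some false else st)
  else if r./2 == sync N then
    Node r.+1 N v (recolour (7 + 2 * loglogb N) (logb N) v [seq m.1 | m <- msgs]) ss st
  else if r./2 == (sync N).+1 then
    Node r.+1 N v k
      (sync N + 2 + recolour (9 + loglogb N) 4 k [seq m.2 | m <- msgs] :: ss) st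
  else
    Node r.+1 N v k ss
      (if [&& st == None, r./2 \in ss & msgs == [::]] then Some true else st).

Definition mis_algo : algo := {|
  St := node;
  rbits N := size (hazards N) * block N;
  init N v _ bits := Node 0 N v 0 (early_slots N bits) None;
  wake := node_wake;
  send := node_send;
  step := node_step;
  output s := status s == Some true |}.

End Algorithm.

(** * Clocks, slots and awake rounds in an execution *)

Section Simulation.
Variables (n : nat) (e : rel 'I_n) (N : nat) (id : 'I_n -> nat) (rnd : 'I_n -> seq bool).
Hypotheses (e_sym : symmetric e) (e_irr : irreflexive e).

Definition node_at r v : node := run mis_algo e N id rnd r v.
#[local] Arguments node_at r v : simpl never.
Definition inbox r v := received mis_algo e id (node_at r) r v.
Definition unit_of r v := r./2 \in units N (slots (node_at r v)).

Lemma node_atS r v : node_at r.+1 v =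
  if is_awake mis_algo (node_at r v) r then node_step (node_at r v) r (inbox r v)
  else node_at r v.
Proof. by []. Qed.

Lemma node_constants r v : bound (node_at r v) = N /\ name (node_at r v) = id v.
Proof.
elim: r => [//|r [Nr vr]]; rewrite node_atS; case: ifP => // _.
by case: (node_at r v) Nr vr => ? ? ? ? ? ? /= -> ->; do !case: ifP.
Qed.

Lemma slots_step r v : r != (sync N).*2 + 3 -> slots (node_at r.+1 v) = slots (node_at r v).
Proof.
move=> neq; rewrite node_atS; case: ifP => // _.
case: (node_at r v) (node_constants r v) => ? ? ? ? ? ? /= [-> ->].
case: (boolP (odd r)) => //= oddr; case: ifP => //= _; case: ifP => //= /eqP half.
by move: neq; rewrite -(odd_double_half r) oddr half doubleS; lia.
Qed.

Lemma slots_early r v : r <= (sync N).*2 + 3 -> slots (node_at r v) = early_slots N (rnd v).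
Proof.
elim: r => [//|r IH] rle; rewrite slots_step; first by apply: IH; lia.
by apply/eqP; lia.
Qed.

Lemma slots_late r v : (sync N).*2 + 4 <= r ->
  slots (node_at r v) = slots (node_at ((sync N).*2 + 4) v).
Proof.
move/subnKC <-; elim: (r - _) => [|m IH]; first by rewrite addn0.
by rewrite addnS slots_step //; apply/eqP; lia.
Qed.

Lemma wake_next s r : clock s <= r ->
  (forall x, clock s <= x < r -> x < (last_slot (bound s)).*2 ->
     x./2 \notin units (bound s) (slots s)) ->
  (node_wake s == Some r) =
  (r < (last_slot (bound s)).*2) && (r./2 \in units (bound s) (slots s)).
Proof.
rewrite /node_wake; set T0 := (last_slot _).*2; set P := fun x => _ \in _ => le_r asleep.
have ohead_mem (l : seq nat) x : ohead l = Some x -> x \in l.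
  by case: l => //= y l [->]; rewrite inE eqxx.
have [rT|Tr] /= := ltnP r T0; last first.
  apply/negbTE/eqP => /ohead_mem; rewrite mem_filter mem_iota => /andP[_].
  by lia.
have -> : T0 - clock s = (r - clock s) + (T0 - r.+1).+1 by lia.
rewrite iotaD subnKC // filter_cat (_ : [seq x <- iota _ (r - _) | _] = [::]) /=.
  rewrite -[RHS]/(P r); case: (P r) => /=; first by rewrite eqxx.
  apply/negbTE/eqP => /ohead_mem; rewrite mem_filter mem_iota => /andP[_].
  by lia.
apply/eqP; rewrite -size_eq0 size_filter -leqn0 leqNgt -has_count.
apply/hasPn => x; rewrite mem_iota => xr; apply: asleep; lia.
Qed.

(** No scheduled round is ever skipped, which makes being awake a matter of the round and the slots
    alone. *)
Lemma clock_inv r v : clock (node_at r v) <= r /\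
  forall x, clock (node_at r v) <= x < r -> x < (last_slot N).*2 ->
    x./2 \notin units N (slots (node_at r v)).
Proof.
elim: r => [|r [le_r asleep]]; first by split=> // x; rewrite ltn0 andbF.
rewrite node_atS; case: ifPn => aw.
  suff -> : clock (node_step (node_at r v) r (inbox r v)) = r.+1.
    by split=> // x /andP[lt1 lt2]; lia.
  by case: (node_at r v) => ? ? ? ? ? ? /=; do !case: ifP.
have [bN _] := node_constants r v.
split=> [|x /andP[xge]]; first exact: ltnW.
rewrite ltnS leq_eqVlt => /predU1P[xr|xr] xT; last by apply: asleep; rewrite ?xge.
subst x; move: aw; rewrite /is_awake /= wake_next ?bN //.
by rewrite xT.
Qed.

Lemma awakeE r v : is_awake mis_algo (node_at r v) r = (r < (last_slot N).*2) && unit_of r v.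
Proof.
have [le_r asleep] := clock_inv r v; have [bN _] := node_constants r v.
by rewrite /is_awake /= wake_next ?bN.
Qed.

Lemma terminated r v : (last_slot N).*2 <= r -> node_wake (node_at r v) = None.
Proof.
move=> Tr; have [le_r asleep] := clock_inv r v; have [bN _] := node_constants r v.
rewrite /node_wake bN; set s := filter _ _; case E: s => [//|x s'].
have : x \in s by rewrite E inE eqxx.
rewrite mem_filter mem_iota => /andP[xu xr]; move: (asleep x).
by rewrite xu => /(_ ltac:(lia) ltac:(lia)).
Qed.

Lemma sync_awake v r : (r./2 == sync N) || (r./2 == (sync N).+1) ->
  is_awake mis_algo (node_at r v) r.
Proof.
move=> rs; rewrite awakeE /unit_of /units !inE orbA rs /= andbT.
have : 0 < 2 ^ (10 + loglogb N) * 2 ^ (10 + loglogb N) by rewrite muln_gt0 !expn_gt0.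
rewrite /last_slot; move: (_ * _) => K; move: rs; rewrite -{3}(odd_double_half r).
by case: (odd r); lia.
Qed.

End Simulation.

#[global] Arguments node_at n e N id rnd r v : simpl never.
(** * The algorithm follows the idealized process *)

Section Correspondence.
Variables (n : nat) (e : rel 'I_n) (N : nat) (id : 'I_n -> nat) (rnd : 'I_n -> seq bool).
Hypotheses (e_sym : symmetric e) (e_irr : irreflexive e).
Notation node_at := (node_at e N id rnd).
Notation inbox := (inbox e N id rnd).
Notation awake_in t v := (unit_of e N id rnd t.*2 v).
Notation c0 := (sync N).
Notation tmax := (last_slot N).
Implicit Types (s t : nat) (u v : 'I_n).

Definition final_slot v := head 0 (slots (node_at (c0.*2 + 4) v)).

Definition slot_marks t : {set 'I_n} :=
  if t < c0 then marks (hazards N) (block N) rnd t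
  else if t < c0 + 2 then set0 else [set v | final_slot v == t].

Definition resets t := (t == second_run N) || (t == c0).

Definition ideal := process e slot_marks resets.
Definition pre := before e slot_marks resets.

Lemma final_slotE v : final_slot v = c0 + 2 + recolour (9 + loglogb N) 4
  (colour (node_at (c0.*2 + 3) v)) [seq m.2 | m <- inbox (c0.*2 + 3) v].
Proof.
rewrite /final_slot addnS node_atS sync_awake; last by apply/orP; right; apply/eqP; lia.
have [] := node_constants e N id rnd (c0.*2 + 3) v; move: (inbox _ _) => l.
have oddr : odd (c0.*2 + 3) by rewrite oddD odd_double.
have half : (c0.*2 + 3)./2 = c0.+1 by lia.
case: (node_at _ v) => cl b nm k ss st bN _; rewrite /= in bN; rewrite bN /node_step oddr half.
by rewrite eqxx gtn_eqF.
Qed.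

Lemma slots_final v : slots (node_at (c0.*2 + 4) v) = final_slot v :: early_slots N (rnd v).
Proof.
rewrite final_slotE -(slots_early e id rnd v (leqnn _)) addnS node_atS.
rewrite sync_awake; last by apply/orP; right; apply/eqP; lia.
have [] := node_constants e N id rnd (c0.*2 + 3) v; move: (inbox _ _) => l.
have oddr : odd (c0.*2 + 3) by rewrite oddD odd_double.
have half : (c0.*2 + 3)./2 = c0.+1 by lia.
case: (node_at _ v) => cl b nm k ss st bN _; rewrite /= in bN; rewrite bN /node_step oddr half.
by rewrite eqxx gtn_eqF.
Qed.

Lemma final_slot_lt v : c0 + 2 <= final_slot v < tmax.
Proof. by rewrite final_slotE leq_addr ltn_add2l recolour_lt. Qed.

Lemma slots_before t v : t < c0 + 2 -> slots (node_at t.*2 v) = early_slots N (rnd v).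
Proof. by move=> tc; rewrite slots_early //; lia. Qed.

Lemma slots_after t v : c0 + 2 <= t ->
  slots (node_at t.*2 v) = final_slot v :: early_slots N (rnd v).
Proof. by move=> tc; rewrite slots_late ?slots_final //; lia. Qed.

Lemma mem_first_mark bits t m x :
  reflect [/\ t <= x < t + m, marked (hazards N) (block N) bits x
            & forall y, t <= y < x -> ~~ marked (hazards N) (block N) bits y]
          (x \in first_mark N bits t m).
Proof.
rewrite /first_mark; elim: m t => [|m IH] t /=; first by apply: ReflectF; case; lia.
have [mt|nt] := boolP (marked _ _ bits t).
  rewrite /= take0 inE; apply: (iffP eqP) => [->|[xr _ none]].
    by split=> // [|y]; lia.
  by apply/eqP; apply: contraTT mt => neq; apply: none; lia.
apply: (iffP (IH t.+1)) => -[xr mx none]; split=> //; first by lia.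
- move=> y yx; have [->//|neq] := eqVneq y t; apply: none; lia.
- suff : x != t by lia.
  by apply: contraNneq nt => <-.
by move=> y yx; apply: none; lia.
Qed.

Lemma second_run_le : second_run N <= c0.
Proof. by rewrite /sync /hazards size_cat leq_addr. Qed.

Lemma early_slots_lt x bits : x \in early_slots N bits -> x < c0.
Proof.
have := second_run_le; rewrite mem_cat => le /orP[] /mem_first_mark[]; lia.
Qed.

Lemma has_resets s t : s < t ->
  has resets (iota s.+1 (t - s)) = (s < second_run N <= t) || (s < c0 <= t).
Proof.
move=> st; apply/hasP/orP => [[x]|[] xr].
- by rewrite mem_iota => xr /orP[] /eqP xE; [left | right]; lia.
- by exists (second_run N); rewrite ?mem_iota /resets ?eqxx //; lia.
by exists c0; rewrite ?mem_iota /resets ?eqxx ?orbT //; lia.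
Qed.

(** A marked node is unspent exactly at its first mark since the last reset, and the program takes
    precisely these slots. *)
Lemma candidateE t v : (t < c0) || (c0 + 2 <= t) ->
  (v \in slot_marks t) && (v \notin spent (pre t)) = (t \in slots (node_at t.*2 v)).
Proof.
have le1 := second_run_le; rewrite /pre spent_before -all_predC.
case/orP => tc; last first.
  rewrite slots_after // inE /slot_marks.
  have -> : (t < c0) = false by lia.
  have -> : (t < c0 + 2) = false by lia.
  rewrite inE (_ : (t \in early_slots _ _) = false); last first.
    by apply/negP => /early_slots_lt; lia.
  rewrite orbF eq_sym; case: eqP => //= tE; apply/allP => s; rewrite mem_iota /= => st.
  rewrite has_resets // negb_and negbK.
  have [sc|sc] := ltnP s c0; first by apply/orP; right; apply/orP; right; lia.
  apply/orP; left; have [sc2|sc2] := ltnP s (c0 + 2); first by rewrite inE.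
  by rewrite inE; lia.
rewrite slots_before ?(ltn_addr _ tc) // /slot_marks tc.
rewrite mem_cat inE; apply/andP/orP => [[mt /allP none]|].
  have [t1|t1] := ltnP t (second_run N); [left|right].
    apply/mem_first_mark; split=> // y yt; have := none y.
    rewrite mem_iota /= has_resets; last by lia.
    have -> : y < c0 by lia.
    rewrite inE => /(_ yt); apply: contra => ->; rewrite /=; lia.
  apply/mem_first_mark; split=> //; first by lia.
  move=> y yt; have := none y; rewrite mem_iota /= has_resets; last by lia.
  have -> : y < c0 by lia.
  by rewrite inE => /(_ ltac:(lia)); apply: contra => ->; rewrite /=; lia.
case=> /mem_first_mark[tr mt none]; split=> //; apply/allP => y; rewrite mem_iota /= => yt;
  rewrite has_resets // negb_and negbK; have -> : y < c0 by [lia].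
- by apply/orP; left; rewrite inE; apply: none; lia.
have [y1|y1] := ltnP y (second_run N); first by apply/orP; right; lia.
by apply/orP; left; rewrite inE; apply: none; lia.
Qed.

Lemma levels_gt0 : 0 < levels N.
Proof.
rewrite /levels up_log_gt0 /= /last_slot.
by apply: leq_trans (leq_addr _ _); rewrite addn2.
Qed.

Lemma last_slot_pow t : t < tmax -> t < 2 ^ levels N.
Proof. by move=> /leq_trans; apply; apply: up_logP. Qed.

Lemma unit_mem t x ss : t \in ss -> x \in rendezvous (levels N) t -> x \in units N ss.
Proof.
move=> ts xt; rewrite /units !inE; apply/orP; right; apply/orP; right.
by apply/flattenP; exists (rendezvous (levels N) t) => //; apply: map_f.
Qed.

Lemma unit_slot t v : t \in slots (node_at t.*2 v) -> awake_in t v.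
Proof.
by move=> tv; rewrite /unit_of doubleK (unit_mem tv) // mem_rendezvous // levels_gt0.
Qed.

Lemma unit_sync t v : (t == c0) || (t == c0.+1) -> awake_in t v.
Proof. by move=> tc; rewrite /unit_of doubleK /units !inE orbA tc. Qed.

(** Slots on the same side of the colouring share a rendezvous; otherwise a colouring unit, where
    all nodes are awake, serves as meeting point. *)
Lemma common_unit s t u v : s < t < tmax ->
  (s < c0) || (c0 + 2 <= s) -> s \in slots (node_at s.*2 u) ->
  (t \in slots (node_at t.*2 v)) || (t == c0) || (t == c0.+1) ->
  exists x, [/\ s < x, x <= t, awake_in x u & awake_in x v].
Proof.
move=> /andP[st tT] sc su; rewrite -orbA => /orP[tv|tc]; last first.
  by exists t; rewrite !unit_sync.
have [x [sx xt xs xt']] := rendezvous_common st (last_slot_pow tT).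
case/orP: sc => sc; last first.
  rewrite slots_after // in su; rewrite slots_after in tv; last by lia.
  exists x; rewrite /unit_of !doubleK !slots_after; try lia.
  by rewrite (unit_mem su) // (unit_mem tv).
have [tc|tc] := ltnP t c0.
  rewrite slots_before in su; last by lia.
  rewrite slots_before in tv; last by lia.
  exists x; rewrite /unit_of !doubleK !slots_before; try lia.
  by rewrite (unit_mem su) // (unit_mem tv).
by exists c0; rewrite !unit_sync ?eqxx.
Qed.

End Correspondence.

(** * Agreement of node statuses with the idealized process *)

Section StatusInvariant.
Variables (n : nat) (e : rel 'I_n) (N : nat) (id : 'I_n -> nat) (rnd : 'I_n -> seq bool).
Hypotheses (e_sym : symmetric e) (e_irr : irreflexive e).
Notation node_at := (node_at e N id rnd).
Notation inbox := (inbox e N id rnd).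
Notation awake_in t v := (unit_of e N id rnd t.*2 v).
Notation c0 := (sync N).
Notation tmax := (last_slot N).
Notation ideal := (ideal e N id rnd).
Notation pre := (pre e N id rnd).
Notation slot_marks := (slot_marks e N id rnd).
Notation status_at r v := (status (node_at r v)).
Implicit Types (s t : nat) (u v : 'I_n).

Lemma half_double1 t : t.*2.+1./2 = t.
Proof. by rewrite -addn1 halfD odd_double doubleK addn0. Qed.

Lemma awake_report t v : t < tmax -> is_awake mis_algo (node_at t.*2 v) t.*2 = awake_in t v.
Proof. by move=> tT; rewrite awakeE ltn_double tT. Qed.

Lemma slots_action t v : slots (node_at t.*2.+1 v) = slots (node_at t.*2 v).
Proof. by apply: slots_step; apply/eqP; lia. Qed.

Lemma awake_action t v : t < tmax ->
  is_awake mis_algo (node_at t.*2.+1 v) t.*2.+1 = awake_in t v.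
Proof.
move=> tT; rewrite awakeE /unit_of slots_action half_double1 doubleK.
by rewrite (_ : _ < _ = true) //; lia.
Qed.

Lemma status_report t v : t < tmax -> status_at t.*2.+1 v =
  if [&& awake_in t v, status_at t.*2 v == None &
      [exists u, [&& e v u, awake_in t u & status_at t.*2 u == Some true]]]
  then Some false else status_at t.*2 v.
Proof.
move=> tT; rewrite node_atS awake_report //; case: ifP => //= av.
have inboxE : (inbox t.*2 v != [::]) =
    [exists u, [&& e v u, awake_in t u & status_at t.*2 u == Some true]].
  rewrite received_nil -[RHS](negbK) negb_exists; congr (~~ _).
  apply/eqP/forallP => [/setP none u|none].
    have := none u; rewrite !inE awake_report //= /node_send odd_double /=.
    by case: (status_at _ u == _); case: (e v u); case: (unit_of _ _ _ _ _ u).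
  apply/setP => u; have := none u; rewrite !inE awake_report //= /node_send odd_double /=.
  by case: (status_at _ u == _); case: (e v u); case: (unit_of _ _ _ _ _ u).
rewrite -inboxE; case: (node_at t.*2 v) => ? ? ? ? ? ? /=.
by rewrite odd_double.
Qed.

Definition applicant t v := (status_at t.*2.+1 v == None) && (t \in slots (node_at t.*2 v)).

Lemma status_action t v : t < tmax -> t != c0 -> t != c0.+1 ->
  status_at t.+1.*2 v =
  if applicant t v && ~~ [exists u, e v u && applicant t u] then Some true
  else status_at t.*2.+1 v.
Proof.
move=> tT tc tc1; rewrite doubleS node_atS awake_action //.
case: (boolP (awake_in t v)) => [av|nav]; last first.
  rewrite /applicant; case: (boolP (t \in _)) => [/unit_slot av|_]; last by rewrite andbF.
  by rewrite av in nav.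
have inboxE : (inbox t.*2.+1 v == [::]) = ~~ [exists u, e v u && applicant t u].
  rewrite received_nil negb_exists.
  have speakE u : (u \in speakers (A := mis_algo) e id (node_at t.*2.+1) t.*2.+1 v)
      = e v u && applicant t u.
    rewrite inE awake_action //= /node_send /= odd_double /=; congr (_ && _).
    have [-> _] := node_constants e N id rnd t.*2.+1 u.
    rewrite uphalf_double (negbTE tc) (negbTE tc1) slots_action /applicant.
    case: (status_at _ u == None) => /=; last by rewrite andbF.
    case: (boolP (t \in _)) => [/unit_slot ->|] //; by rewrite andbF.
  apply/eqP/forallP => [/setP none u|none]; first by rewrite -speakE none inE.
  by apply/setP => u; rewrite speakE (negbTE (none u)) inE.
have [] := node_constants e N id rnd t.*2.+1 v.
rewrite -inboxE /applicant -slots_action; case: (node_at t.*2.+1 v) => ? b ? ? ? ? /= -> _.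
rewrite odd_double /= uphalf_double (negbTE tc) (negbTE tc1) /=.
by rewrite andbA.
Qed.

Lemma status_action_sync t v : t < tmax -> (t == c0) || (t == c0.+1) ->
  status_at t.+1.*2 v = status_at t.*2.+1 v.
Proof.
move=> tT tc; rewrite doubleS node_atS; case: ifP => // _.
have [] := node_constants e N id rnd t.*2.+1 v.
case: (node_at t.*2.+1 v) => ? b ? ? ? ? /= -> _; rewrite odd_double /= uphalf_double.
by case/orP: tc => tc; rewrite tc //; case: ifP.
Qed.

(* A dominated node need not know yet that it is dominated: the third clause says that
   it does know if it has ever been awake together with a neighbour that had joined. *)
Definition tracks t :=
  [/\ forall v, (status_at t.*2 v == Some true) = (v \in joined (ideal t)),
      forall v, v \in undec (ideal t) -> status_at t.*2 v = None
    & forall v, status_at t.*2 v = None -> forall s u, s < t -> e v u ->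
        u \in joined (ideal s) -> awake_in s u -> awake_in s v -> False].

Lemma candidatesE t : t < tmax -> t != c0 -> t != c0.+1 -> forall v,
  (v \in active (pre t) :&: slot_marks t) =
  (v \in undec (ideal t)) && (t \in slots (node_at t.*2 v)).
Proof.
move=> tT tc tc1 v; rewrite -candidateE; last by lia.
rewrite in_setI in_setD undec_before.
by case: (v \in spent _); case: (v \in undec _); case: (v \in slot_marks t).
Qed.

(** The fourth clause says that a dominated node knows it before acting: the dominating neighbour
    joined at some [s < t], both are awake at a common unit in [(s, t]], and the neighbour announces
    itself there. *)
Lemma tracks_report t : t < tmax -> tracks t ->
  [/\ forall v, (status_at t.*2.+1 v == Some true) = (v \in joined (ideal t)),
      forall v, v \in undec (ideal t) -> status_at t.*2.+1 v = None,
      forall v, status_at t.*2.+1 v = None -> forall s u, s <= t -> e v u ->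
        u \in joined (ideal s) -> awake_in s u -> awake_in s v -> False
    & forall v, status_at t.*2.+1 v = None ->
        [|| t \in slots (node_at t.*2 v), t == c0 | t == c0.+1] -> v \in undec (ideal t)].
Proof.
move=> tT [joinE undecN heard].
have [_ sep cover] := consistent_process e_sym slot_marks (resets N) t.
have joinE' v : (status_at t.*2.+1 v == Some true) = (v \in joined (ideal t)).
  by rewrite status_report // -joinE; case: ifP => // /and3P[_ /eqP-> _].
have heard' v : status_at t.*2.+1 v = None -> forall s u, s <= t -> e v u ->
    u \in joined (ideal s) -> awake_in s u -> awake_in s v -> False.
  rewrite status_report //; case: ifP => // /negP nheard stN s u.
  rewrite leq_eqVlt => /predU1P[->|st] evu ju au av; last exact: (heard v stN s u).
  apply: nheard; rewrite av stN eqxx; apply/existsP; exists u.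
  by rewrite evu au joinE.
split=> // v.
  move=> vU; rewrite status_report // undecN //; case: ifP => // /and3P[_ _].
  case/existsP=> u /and3P[evu _]; rewrite joinE => ju.
  by have /andP[_] := sep u v ju vU; rewrite e_sym evu.
move=> stN tv; case/or3P: (cover v) => //.
  by rewrite -[v \in joined _]joinE' stN.
case/'exists_andP => u [ju evu]; exfalso.
have [s [st win js]] := joined_at ju.
have us : u \in slot_marks s by move: win; rewrite !inE => /andP[/andP[]].
have sc : (s < c0) || (c0 + 2 <= s).
  move: us; rewrite /slot_marks; case: ltnP => //= _; case: ltnP => //=.
  by rewrite inE.
have su : s \in slots (node_at s.*2 u).
  by rewrite -candidateE // us; move: win; rewrite !inE => /andP[/andP[/andP[]]].
have stT : s < t < tmax by rewrite st.
rewrite orbA in tv; have [x [sx xt au av]] := common_unit stT sc su tv.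
apply: (heard' v stN x u) => //.
exact: (subsetP (joined_mono e slot_marks (resets N) sx)).
Qed.

(** The nodes speaking at a slot are exactly the candidates of the idealized process, so hearing
    silence identifies the winners; nobody joins in the colouring units. *)
Lemma tracksS t : t < tmax -> tracks t -> tracks t.+1.
Proof.
move=> tT tr; have [joinE undecN heard late] := tracks_report tT tr.
have [_ sep _] := consistent_process e_sym slot_marks (resets N) t.+1.
have undecS v : v \in undec (ideal t.+1) -> v \in undec (ideal t).
  by apply: subsetP; apply: undec_mono.
have [sync_t|nsync] := boolP ((t == c0) || (t == c0.+1)).
  split=> v; rewrite status_action_sync //.
  - rewrite joinE [in RHS]/ideal joinedS in_setU [v \in winners _ _ _]inE in_setI.
    have -> : slot_marks t = set0; last by rewrite in_set0 andbF orbF.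
    rewrite /slot_marks; case: ltnP => [|_]; first by case/orP: sync_t => /eqP ->; lia.
    by case: ltnP => //; case/orP: sync_t => /eqP ->; lia.
  - by move/undecS/undecN.
  by move=> stN s u; rewrite ltnS; apply: heard.
have [tc tc1] : t != c0 /\ t != c0.+1 by move: nsync; rewrite negb_or => /andP.
have applE v : applicant t v = (v \in active (pre t) :&: slot_marks t).
  rewrite candidatesE // /applicant; case: (boolP (t \in _)) => [tv|_]; last by rewrite !andbF.
  rewrite !andbT; apply/eqP/idP => [stN|/undecN //].
  by apply: late; rewrite ?tv.
have winE v : (v \in winners e (pre t) (slot_marks t)) =
    applicant t v && ~~ [exists u, e v u && applicant t u].
  rewrite inE -applE; congr (_ && _); rewrite negb_exists; apply: eq_forallb => u.
  by rewrite applE negb_and implybE orbC.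
split=> v; rewrite status_action // -winE.
- rewrite /ideal joinedS in_setU -joinE -/(pre t).
  by case: (v \in winners _ _ _) => /=; rewrite ?orbT ?orbF ?eqxx.
- move=> vU; case: ifP => [vw|_]; last exact/undecN/undecS.
  have vj : v \in joined (ideal t.+1) by rewrite /ideal joinedS in_setU -/(pre t) vw orbT.
  by have := sep v v vj vU; rewrite eqxx.
by case: ifP => // _ stN s u; rewrite ltnS; apply: heard.
Qed.

Lemma tracks_all t : t <= tmax -> tracks t.
Proof.
elim: t => [_|t IH lt]; last by apply: tracksS => //; apply: IH; apply: ltnW.
by split=> [v|v|v _ s u]; rewrite ?inE.
Qed.

End StatusInvariant.
(** * Outcome and complexity *)

Section Outcome.
Variables (n : nat) (e : rel 'I_n) (N : nat) (id : 'I_n -> nat) (rnd : 'I_n -> seq bool).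
Hypotheses (e_sym : symmetric e) (e_irr : irreflexive e).
Hypotheses (id_inj : injective id) (id_lt : forall v, id v < N).
Notation node_at := (node_at e N id rnd).
Notation inbox := (inbox e N id rnd).
Notation c0 := (sync N).
Notation tmax := (last_slot N).
Notation ideal := (ideal e N id rnd).
Notation pre := (pre e N id rnd).
Notation slot_marks := (slot_marks e N id rnd).
Notation final_slot := (final_slot e N id rnd).
Notation status_at r v := (status (node_at r v)).
Notation L := (logb N).
Notation l := (loglogb N).
Implicit Types (s t : nat) (u v : 'I_n).

Lemma node_at_end r v : tmax.*2 <= r -> node_at r v = node_at tmax.*2 v.
Proof.
move/subnKC <-; elim: (r - _) => [|m IH]; first by rewrite addn0.
by rewrite addnS node_atS awakeE ltnNge leq_addr.
Qed.

Lemma output_set r : tmax.*2 <= r ->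
  [set v | status_at r v == Some true] = joined (ideal tmax).
Proof.
have [joinE _ _] := tracks_all id rnd e_sym (leqnn tmax).
by move=> Tr; apply/setP => v; rewrite inE node_at_end.
Qed.

Lemma independent_joined t : independent e (joined (ideal t)).
Proof.
have [indep _ _] := consistent_process e_sym slot_marks (resets N) t.
apply/forallP => u; apply/forallP => v; apply/implyP => euv.
by apply/negP => /andP[ju jv]; have := indep u v ju jv; rewrite euv.
Qed.

Lemma maximal_joined t : undec (ideal t) = set0 -> maximal_independent e (joined (ideal t)).
Proof.
have [_ _ cover] := consistent_process e_sym slot_marks (resets N) t.
move=> none; rewrite /maximal_independent independent_joined /=; apply/forallP => v.
case/or3P: (cover v) => [->//||/'exists_andP[u [ju evu]]].
  by rewrite -/(ideal t) none inE.
by apply/orP; right; apply/existsP; exists u; rewrite evu.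
Qed.

Lemma size_early_slots bits : size (early_slots N bits) <= 2.
Proof.
rewrite size_cat /first_mark !size_take -(addn1 1).
by apply: leq_add; case: ltnP.
Qed.

Lemma size_units ss : size (units N ss) = 2 + size ss * (2 * levels N).
Proof.
rewrite /units /= size_flatten /shape -map_comp.
by elim: ss => //= s ss IH; rewrite size_rendezvous; lia.
Qed.

Lemma awake_units r v : is_awake mis_algo (node_at r v) r ->
  r./2 \in units N (slots (node_at (c0.*2 + 4) v)).
Proof.
rewrite awakeE /unit_of => /andP[_]; have [late|early] := leqP (c0.*2 + 4) r.
  by rewrite slots_late.
rewrite slots_early ?slots_final; last by lia.
rewrite /units !inE map_cons /= mem_cat.
by case/or3P => ->; rewrite ?orbT.
Qed.

(** Every unit has two rounds; there are two colouring units and at most three slots with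
    [2 * levels N] rendezvous each. *)
Lemma energy_le T v : energy mis_algo e N id rnd T v <= 4 + 12 * levels N.
Proof.
pose us := units N (slots (node_at (c0.*2 + 4) v)).
apply: (@leq_trans (size ([seq x.*2 | x <- us] ++ [seq x.*2.+1 | x <- us]))).
  rewrite /energy -size_filter; apply: uniq_leq_size; first by rewrite filter_uniq ?iota_uniq.
  move=> r; rewrite mem_filter => /andP[/awake_units ru _].
  rewrite mem_cat; apply/orP; rewrite -(odd_double_half r); case: (odd r); [right|left].
    by rewrite add1n; apply: map_f.
  by rewrite add0n; apply: map_f.
rewrite size_cat !size_map size_units slots_final /=.
have := size_early_slots (rnd v); move: (size _) => k; nia.
Qed.

Lemma colour_bound r v : colour (node_at r v) < 2 ^ (8 + 2 * l) * 2 ^ (8 + 2 * l).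
Proof.
elim: r => [|r IH]; first by rewrite muln_gt0 !expn_gt0.
rewrite node_atS; case: ifP => // _.
have [] := node_constants e N id rnd r v; move: (inbox r v) IH => msgs.
case: (node_at r v) => ? b ? ? ? ? /= IH -> _; do !case: ifP => //= _.
exact: recolour_lt.
Qed.

Lemma message_bound r v j m : node_send (node_at r v) r j = Some m ->
  m < 2 ^ (8 + 2 * l) * 2 ^ (8 + 2 * l).
Proof.
have pos : 0 < 2 ^ (8 + 2 * l) * 2 ^ (8 + 2 * l) by rewrite muln_gt0 !expn_gt0.
rewrite /node_send; do !case: ifP => _ //; case=> <- //.
exact: colour_bound.
Qed.

Lemma logb_bounds : [/\ 0 < L, L <= 2 ^ l, l <= L, N <= 2 ^ L & 2 ^ l <= 2 * L].
Proof.
split=> //.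
- exact: up_logP.
- by apply: up_log_min => //; apply/ltnW/ltn_expl.
- by apply: leq_trans (up_logP _ (ltnSn 1)) _; rewrite leq_exp2l.
rewrite /loglogb; have [L1|L1] := leqP L 1.
  by rewrite (_ : L = 1) ?up_log1 //; apply/eqP; rewrite eqn_leq L1.
have := up_log_gtn (ltnSn 1) L1; case: (up_log 2 L) => [|k] /= kL; first by lia.
by rewrite expnS leq_mul2l ltnW.
Qed.

(** All nodes are awake in these units, so every dominated node has learnt its status. *)
Lemma undecided_status t v : (t == c0) || (t == c0.+1) ->
  (status_at t.*2.+1 v == None) = (v \in undec (ideal t)).
Proof.
move=> tc; have tT : t < tmax.
  rewrite /last_slot; apply: leq_trans (leq_addr _ _).
  by case/orP: tc => /eqP ->; lia.
have [_ undecN _ late] := tracks_report e_sym tT (tracks_all id rnd e_sym (ltnW tT)).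
apply/eqP/idP => [stN|/undecN //]; apply: late => //.
by apply/or3P; case/orP: tc => ->; [constructor 2 | constructor 3].
Qed.

Lemma colour_speakers t v : (t == c0) || (t == c0.+1) ->
  speakers (A := mis_algo) e id (node_at t.*2.+1) t.*2.+1 v = nbrs e v :&: undec (ideal t).
Proof.
move=> tc; apply/setP => u; rewrite !inE -undecided_status //.
have half := half_double1 t.
rewrite sync_awake ?half //= /node_send half /= odd_double /=.
have [-> _] := node_constants e N id rnd t.*2.+1 u.
by case: (e v u) => //=; case: (status_at _ u == None) => //=; case/orP: tc => -> //; case: ifP.
Qed.

Definition first_colour v :=
  recolour (7 + 2 * l) L (id v) [seq m.1 | m <- inbox c0.*2.+1 v].

Lemma colourE v : colour (node_at (c0.*2 + 3) v) = first_colour v.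
Proof.
have half := half_double1 c0.
have -> : c0.*2 + 3 = c0.*2.+3 by rewrite addn3.
transitivity (colour (node_at c0.*2.+2 v)).
  rewrite node_atS; case: ifP => // _; case: (node_at _ v) => ? ? ? ? ? ?.
  by rewrite /node_step /= negbK odd_double.
rewrite node_atS sync_awake ?half ?eqxx //.
have [] := node_constants e N id rnd c0.*2.+1 v; rewrite /first_colour.
move: (inbox _ v) => msgs; case: (node_at _ v) => ? b nm k ss st /= -> ->.
by rewrite odd_double /= uphalf_double eqxx.
Qed.

Lemma send_colour r v j : odd r -> r./2 = c0.+1 ->
  node_send (node_at r v) r j =
  if status_at r v != None then None else Some (colour (node_at r v)).
Proof.
move=> oddr half; rewrite /node_send oddr half; have [-> _] := node_constants e N id rnd r v.
by rewrite gtn_eqF // eqxx.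
Qed.

Hypothesis sparse0 : sparse e (2 ^ (8 + l)) (ideal c0).

Lemma c0_lt : c0.+2 <= tmax.
Proof. by rewrite /last_slot; apply: leq_trans (leq_addr _ _); rewrite addn2. Qed.

(** At most [2 ^ (8 + l)] neighbours, each with at most [L.-1 < 2 ^ l] collisions, cannot fill a
    field of [2 ^ (8 + 2 * l)] elements. *)
Lemma first_colour_proper u v : u \in undec (ideal c0) -> v \in undec (ideal c0) ->
  e v u -> first_colour v != first_colour u.
Proof.
move=> uU vU evu.
have [L0 Ll lL NL _] := logb_bounds.
have idL w : id w < (2 ^ (7 + 2 * l).+1) ^ L.
  apply: leq_trans (id_lt w) (leq_trans NL _); rewrite -expnM leq_exp2l //.
  by rewrite leq_pmull.
apply: recolour_proper => //.
- move=> x /mapP[m /mem_received[w [evw _ _ <-]] ->]; split=> //.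
  by apply: contraTneq evw => /id_inj ->; rewrite e_irr.
- rewrite size_map size_received colour_speakers ?eqxx //.
  have dv := implyP (forallP sparse0 v) vU; rewrite -[(7 + _).+1]/(8 + 2 * l).
  rewrite mul2n -addnn addnA expnD; apply: (@leq_ltn_trans (2 ^ (8 + l) * L.-1)).
    by rewrite leq_mul2r dv orbT.
  by rewrite ltn_pmul2l ?expn_gt0 //; apply: leq_trans Ll; rewrite prednK.
have : u \in speakers (A := mis_algo) e id (node_at c0.*2.+1) c0.*2.+1 v.
  by rewrite colour_speakers ?eqxx // in_setI uU andbT inE.
rewrite inE => /and3P[_ au]; case E: (send _ _ _ _) => [m|] // _.
apply/mapP; exists (id u, m) => //; apply/mem_received.
by exists u.
Qed.

(** First colours are below [2 ^ (16 + 4 * l)], so degree below 4 suffices over [2 ^ (10 + l)]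
    elements, more than the at most [3 * 2 ^ (8 + l)] collisions. *)
Lemma final_slot_proper u v : u \in undec (ideal c0.+1) -> v \in undec (ideal c0.+1) ->
  e v u -> final_slot v != final_slot u.
Proof.
move=> uU vU evu.
have [L0 Ll lL NL _] := logb_bounds.
have sub w : w \in undec (ideal c0.+1) -> w \in undec (ideal c0).
  by apply: subsetP; apply: undec_mono.
have rE : c0.*2 + 3 = c0.+1.*2.+1 by lia.
have sendE w : send mis_algo (node_at (c0.*2 + 3) w) (c0.*2 + 3) (id v) =
    if status_at (c0.*2 + 3) w != None then None else Some (first_colour w).
  rewrite -colourE; apply: send_colour; first by rewrite oddD odd_double.
  by lia.
have speakE w : w \in nbrs e v :&: undec (ideal c0.+1) ->
    (id w, first_colour w) \in inbox (c0.*2 + 3) v.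
  rewrite -colour_speakers ?eqxx ?orbT // -rE in_set => /and3P[evw aw sw].
  apply/mem_received; exists w; split=> //; move: sw.
  by rewrite sendE; case: ifP.
have heard x : x \in [seq m.2 | m <- inbox (c0.*2 + 3) v] ->
    exists2 w, w \in nbrs e v :&: undec (ideal c0.+1) & x = first_colour w.
  case/mapP => m /mem_received[w [evw aw sw _]] ->; exists w.
    rewrite -colour_speakers ?eqxx ?orbT // -rE in_set evw aw.
    by rewrite sw.
  by move: sw; rewrite sendE; case: ifP => // _ [<-].
have colL w : first_colour w < (2 ^ (9 + l).+1) ^ 4.
  apply: leq_trans (recolour_lt _ _ _ _) _; rewrite -expnD -expnM leq_exp2l //.
  by rewrite !addSn !mulSn; lia.
rewrite !final_slotE !colourE eqn_add2l; apply: recolour_proper => //.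
- move=> x /heard[w]; rewrite in_setI in_set => /andP[evw wU] ->; split=> //.
  by rewrite eq_sym; apply: first_colour_proper; rewrite ?sub.
- rewrite size_map {1}rE size_received colour_speakers ?eqxx ?orbT //.
  apply: (@leq_ltn_trans (2 ^ (8 + l) * 3)).
    rewrite leq_mul2r /=; apply: leq_trans (implyP (forallP sparse0 v) (sub _ vU)).
    by apply: subset_leq_card; apply: setIS; apply/subsetP.
  have -> : (9 + l).+1 = (8 + l) + 2 by lia.
  by rewrite (expnD 2 (8 + l) 2) ltn_pmul2l // expn_gt0.
by apply/mapP; exists (id u, first_colour u) => //; apply: speakE; rewrite in_setI uU andbT inE.
Qed.

(** A node undecided to the end would have collided at its final slot with an undecided neighbour
    owning the same slot, against properness of the colouring. *)
Lemma undec_final : undec (ideal tmax) = set0.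
Proof.
apply/eqP; rewrite -subset0; apply/subsetP => v vU.
have /andP[tge tlt] := final_slot_lt e N id rnd v.
have tc : final_slot v != c0 by rewrite gtn_eqF //; lia.
have tc1 : final_slot v != c0.+1 by rewrite gtn_eqF //; lia.
set t := final_slot v in tge tlt tc tc1.
have undecE s : s <= tmax -> v \in undec (ideal s).
  by move=> sT; apply: (subsetP (undec_mono e slot_marks (resets N) sT)).
have own w : final_slot w = t -> t \in slots (node_at t.*2 w).
  by move=> wt; rewrite slots_after // -wt inE eqxx.
have vC : v \in active (pre t) :&: slot_marks t.
  by rewrite candidatesE // undecE ?own // ltnW.
have [_ sep _] := consistent_process e_sym slot_marks (resets N) t.+1.
have : v \notin winners e (pre t) (slot_marks t).
  apply/negP => vw; have vj : v \in joined (ideal t.+1).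
    by rewrite /ideal joinedS in_setU -/(pre t) vw orbT.
  by have := sep v v vj (undecE _ tlt); rewrite eqxx.
rewrite inE vC /= negb_forall => /existsP[w]; rewrite negb_imply negbK candidatesE //.
case/andP => /andP[wU wt] evw.
have w1 : w \in undec (ideal c0.+1).
  by apply: (subsetP (undec_mono e slot_marks (resets N) _)) wU; lia.
have v1 : v \in undec (ideal c0.+1) by apply: undecE; have := c0_lt; lia.
have := final_slot_proper w1 v1 evw; rewrite -/t.
move: wt; rewrite slots_after // inE => /orP[/eqP <-|/early_slots_lt]; first by rewrite eqxx.
by lia.
Qed.

End Outcome.

(** * Probability that the two random runs leave a dense remainder *)

Section FailureProbability.
Variables (n : nat) (e : rel 'I_n) (N : nat) (id : 'I_n -> nat).
Hypotheses (e_irr : irreflexive e) (leNn : n <= N).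
Notation c0 := (sync N).
Notation I1 := (second_run N).
Notation L := (logb N).
Notation l := (loglogb N).

Section FixedBits.
Variable rnd : 'I_n -> seq bool.
Notation ideal := (ideal e N id rnd).
Notation pre := (pre e N id rnd).
Notation slot_marks := (slot_marks e N id rnd).

Lemma iota_snoc a m : iota a m.+1 = rcons (iota a m) (a + m).
Proof. by rewrite -addn1 iotaD cats1. Qed.

Lemma ideal_first_run t : t <= I1 ->
  ideal t = foldl (slot_step e) (start _) [seq slot_marks s | s <- iota 0 t].
Proof.
elim: t => [//|t IH] tI; rewrite iota_snoc map_rcons -cats1 foldl_cat /= -IH; last exact: ltnW.
by rewrite /refresh_if /resets !ltn_eqF //; apply: leq_trans tI (second_run_le N).
Qed.

(** Stated for [pre], since the reset opening the second run is part of [pre] but not yet of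
    [ideal]. *)
Lemma ideal_second_run m : I1 + m < c0 ->
  pre (I1 + m) =
  foldl (slot_step e) (refresh (ideal I1)) [seq slot_marks s | s <- iota I1 m].
Proof.
elim: m => [|m IH] mc.
  by rewrite addn0 /pre /before /refresh_if /resets eqxx.
rewrite iota_snoc map_rcons -cats1 foldl_cat /= -IH; last by apply: leq_ltn_trans mc; lia.
rewrite /pre {1}/before /refresh_if /resets gtn_eqF; last by lia.
by rewrite ltn_eqF // addnS.
Qed.

Lemma undec_sync : undec (ideal c0) = undec (foldl (slot_step e) (refresh
    (foldl (slot_step e) (start _) [seq slot_marks s | s <- iota 0 I1]))
  [seq slot_marks s | s <- iota I1 (c0 - I1)]).
Proof.
rewrite -ideal_first_run //; have le := second_run_le N.
case E: (c0 - I1) => [|m]; first by have -> : c0 = I1 by [lia].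
have cE : c0 = (I1 + m).+1 by lia.
by rewrite iota_snoc map_rcons -cats1 foldl_cat -ideal_second_run {1}cE.
Qed.

End FixedBits.

Lemma mem_phases len hz m a : a \in phases len hz m -> exists2 k, k < m & a = hz k.
Proof.
elim: m => [//|m IH]; rewrite mem_cat => /orP[/nseqP[-> _]|/IH[k km ->]]; first by exists m.
by exists k => //; apply: ltnW.
Qed.

Lemma hazards_le_block : all (fun a => a <= block N) (hazards N).
Proof.
apply/allP => a; rewrite mem_cat => /orP[] /mem_phases[k kl ->]; rewrite /block; lia.
Qed.

(** The probability is at most [chance L], and [n <= 2 ^ L]; clearing denominators gives the
    count. *)
Lemma not_sparse_rare :
  #|[set f : {ffun 'I_n -> (rbits mis_algo N).-tuple bool} |
      ~~ sparse e (2 ^ (8 + l)) (ideal e N id (fun v => tval (f v)) c0)]| * n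
  <= #|{ffun 'I_n -> (rbits mis_algo N).-tuple bool}|.
Proof.
have [L0 Ll lL NL _] := logb_bounds N.
have nL : #|'I_n| <= 2 ^ L by rewrite card_ord (leq_trans leNn).
pose bad c : rat := (~~ sparse e (2 ^ (8 + l)) c)%:R%R.
pose G (Ms : seq {set 'I_n}) := bad (foldl (slot_step e) (refresh
  (foldl (slot_step e) (start _) (take I1 Ms))) (drop I1 Ms)).
set total := #|{ffun _ -> _}|.
have badE (f : {ffun 'I_n -> (rbits mis_algo N).-tuple bool}) :
    bad (ideal e N id (fun v => tval (f v)) c0) =
    G [seq marks (hazards N) (block N) (fun v => tval (f v)) t | t <- iota 0 c0].
  have iE : iota 0 c0 = iota 0 I1 ++ iota I1 (c0 - I1).
    by rewrite -{1}(subnKC (second_run_le N)) iotaD.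
  rewrite /G /bad /sparse undec_sync iE map_cat.
  rewrite take_size_cat ?drop_size_cat ?size_map ?size_iota //.
  have mE a m : a + m <= c0 -> [seq slot_marks e N id (fun v => tval (f v)) s | s <- iota a m] =
      [seq marks (hazards N) (block N) (fun v => tval (f v)) t | t <- iota a m].
    move=> am; apply/eq_in_map => t; rewrite mem_iota => /andP[_ tm].
    by rewrite /slot_marks (leq_trans tm).
  by rewrite !mE ?subnKC ?second_run_le.
have mean_bad : (expects (hazards N) G <= chance L)%R.
  apply: le_trans (mean_not_sparse e_irr L0 nL Ll lL).
  rewrite /hazards expects_cat /mean le_eqVlt; apply/orP; left; apply/eqP.
  apply: eq_expects => Ms szMs; apply: eq_expects => Ms' _.
  by rewrite /G take_size_cat ?drop_size_cat.
have sumE := sum_marks G hazards_le_block.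
rewrite -(ler_nat rat) natrM -sum1_card natr_sum.
apply: (@le_trans _ _ ((total%:R * chance L) * (2 ^ L)%:R)%R); last first.
  by rewrite -mulrA [(chance L * _)%R]mulrC natrX chanceV mulr1.
apply: ler_pM; rewrite ?sumr_ge0 ?ler0n ?ler_nat //; last by rewrite -[n]card_ord.
apply: (@le_trans _ _ (total%:R * expects (hazards N) G)%R); last by rewrite ler_wpM2l ?ler0n.
rewrite /total -sumE big_mkcond; apply: ler_sum => f _.
by rewrite inE -badE /bad; case: (sparse _ _ _).
Qed.

End FailureProbability.

(** * Bounds on time, energy and message size *)

Section Complexity.
Variables (d : nat).

(** A geometric sum; the extra term on the left makes the induction go through. *)
Lemma size_phases_le len hz m w l : m <= l ->
  (forall k, k < m -> len k = w * 2 ^ (l.-1 - k)) ->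
  size (phases len hz m) + w * 2 ^ (l - m) <= w * 2 ^ l.
Proof.
elim: m => [|m IH] ml lenE; first by rewrite subn0.
rewrite /= size_cat size_nseq lenE //.
have := IH (ltnW ml) (fun k km => lenE k (ltnW km)).
have -> : l - m = (l - m.+1).+1 by lia.
have -> : l.-1 - m = l - m.+1 by lia.
by rewrite expnS mulnCA; lia.
Qed.

Lemma size_phases_const w hz m : size (phases (fun=> w) hz m) = w * m.
Proof. by elim: m => [|m IH] /=; rewrite ?muln0 // size_cat size_nseq IH mulnS. Qed.

(** With [L = logb N] and [l = loglogb N], the random runs take at most [128 * L * L + 128 * L * 2 ^
    l <= 2 ^ (8 + 2 * l)] slots, the last run [2 ^ (20 + 2 * l)]. *)
Lemma last_slot_le N : last_slot N <= 2 ^ (21 + 2 * loglogb N).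
Proof.
have [_ Ll _ _ _] := logb_bounds N.
have c0_le : sync N <= 2 ^ (8 + 2 * loglogb N).
  rewrite /sync /hazards size_cat size_phases_const.
  have := @size_phases_le (fun k => 128 * logb N * 2 ^ ((loglogb N).-1 - k))
    (fun=> 2 * loglogb N + 7) _ (128 * logb N) _ (leqnn _) (fun _ _ => erefl).
  rewrite -/(hazards2 _ _) mul2n -addnn !expnD; move: (size (hazards2 _ _)) => s.
  move: (2 ^ loglogb N) (logb N) Ll => z L Ll.
  have := leq_mul Ll Ll; have := leq_mul Ll (leqnn z).
  by rewrite subnn muln1 -[2 ^ 8]/256 -!mulnA; lia.
have le1 : 2 ^ (8 + 2 * loglogb N) + 2 <= 2 ^ (20 + 2 * loglogb N).
  have -> : 20 + 2 * loglogb N = 12 + (8 + 2 * loglogb N) by [].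
  have pos : 1 < 2 ^ (8 + 2 * loglogb N) by rewrite -{1}(expn0 2) ltn_exp2l.
  apply: (@leq_trans (2 * 2 ^ (8 + 2 * loglogb N))); first by lia.
  by rewrite -expnS leq_exp2l //; lia.
have -> : 21 + 2 * loglogb N = (20 + 2 * loglogb N).+1 by [].
rewrite expnS mul2n -addnn /last_slot; apply: leq_add.
  by apply: leq_trans le1; rewrite leq_add2r.
by rewrite -expnD leq_exp2l //; lia.
Qed.

Lemma logb_le n N : N <= n ^ d -> logb N <= (d * up_log 2 n).+1.
Proof.
move=> Nn; rewrite ltnS; apply: up_log_min => //; apply: leq_trans Nn _.
by rewrite mulnC expnM; case: (d) => // d'; rewrite leq_exp2r // up_logP.
Qed.

Lemma time_bound : exists K, forall n N, N <= n ^ d ->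
  (last_slot N).*2 <= K * up_log 2 n ^ 2 + K.
Proof.
(* A variable hides the constant, which would be huge in unary. *)
have [c cE] : {c | c = 2 ^ 22} by exists (2 ^ 22).
exists (8 * c * (d ^ 2 + 1)) => n N /logb_le; move: (up_log 2 n) => g Lg.
have [_ _ _ _ lL] := logb_bounds N.
apply: (@leq_trans (c * (2 ^ loglogb N * 2 ^ loglogb N))).
  apply: (@leq_trans (2 ^ (21 + 2 * loglogb N)).*2); first by rewrite leq_double last_slot_le.
  by rewrite -mul2n -expnS -expnD addnn -mul2n cE -expnD leq_exp2l //; lia.
apply: (@leq_trans (c * ((2 * (d * g).+1) * (2 * (d * g).+1)))).
  by rewrite leq_mul2l; apply/orP; right; apply: leq_mul; lia.
have h : (d * g).+1 * (d * g).+1 <= 2 * ((d * g) * (d * g) + 1) by nia.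
have -> : c * ((2 * (d * g).+1) * (2 * (d * g).+1)) = (4 * c) * ((d * g).+1 * (d * g).+1) by lia.
apply: (@leq_trans ((4 * c) * (2 * ((d * g) * (d * g) + 1)))).
  by rewrite leq_mul2l h orbT.
have -> : (4 * c) * (2 * ((d * g) * (d * g) + 1)) = (8 * c) * (d ^ 2 * g ^ 2 + 1).
  by rewrite -expnMn -mulnn; lia.
move: (8 * c) (d ^ 2) (g ^ 2) => x y z.
have -> : x * (y + 1) * z + x * (y + 1) = x * (y * z + 1) + x * (y + z) by lia.
exact: leq_addr.
Qed.

Lemma energy_bound : exists K, forall n N, N <= n ^ d ->
  4 + 12 * levels N <= K * up_log 2 (up_log 2 n) + K.
Proof.
exists (24 * (d + 1) + 300) => n N /logb_le; move: (up_log 2 n) => g Lg.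
have lev : levels N <= 21 + 2 * loglogb N by apply: up_log_min => //; apply: last_slot_le.
have ll : loglogb N <= d + up_log 2 g + 1.
  apply: up_log_min => //; apply: leq_trans Lg _; rewrite addn1 expnS expnD.
  have : d * g <= 2 ^ d * 2 ^ up_log 2 g.
    by apply: leq_mul; [apply/ltnW/ltn_expl | apply: up_logP].
  have : 0 < 2 ^ d * 2 ^ up_log 2 g by rewrite muln_gt0 !expn_gt0.
  by move: (_ * _) => x; lia.
by move: (up_log 2 g) ll => k ll; nia.
Qed.

(** Since [2 ^ 8 <= N ^ 8] and [2 ^ loglogb N <= 2 * logb N <= N ^ 2], each factor is at most
    [N ^ 12]. *)
Lemma message_size N : 1 < N -> 2 ^ (8 + 2 * loglogb N) * 2 ^ (8 + 2 * loglogb N) <= N ^ 24.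
Proof.
move=> N1; have [_ _ _ _ lL] := logb_bounds N.
have LN : logb N <= N.
  rewrite /logb -{2}(prednK (ltnW N1)) ltnS; apply: up_log_min => //.
  by rewrite -{1}(prednK (ltnW N1)); apply: ltn_expl.
have lN : 2 ^ loglogb N <= N * N.
  by apply: leq_trans lL _; apply: leq_mul.
have half : 2 ^ (8 + 2 * loglogb N) <= N ^ 12.
  rewrite expnD -[12]/(8 + 4) expnD; apply: leq_mul; first by rewrite leq_exp2r.
  by rewrite mulnC expnM (expnM N 2 2) leq_exp2r // -mulnn.
by rewrite -[24]/(12 + 12) (expnD N); apply: leq_mul.
Qed.

End Complexity.

Theorem theorem1p1 :
  forall d : nat,
  exists A : algo, exists K B p q : nat,
  0 < p /\ 0 < q /\
  forall (n : nat) (e : rel 'I_n), symmetric e -> irreflexive e ->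
  forall N : nat, n <= N <= n ^ d ->
  forall id : 'I_n -> nat, injective id -> (forall v, id v < N) ->
  let T := K * (up_log 2 n) ^ 2 + K in
  (forall f : {ffun 'I_n -> (rbits A N).-tuple bool},
     let rnd := fun v => tval (f v) in
     (* all nodes have terminated after T rounds *)
     (forall v, wake A (run A e N id rnd T v) = None) /\
     (* each node is awake in O(log log n) rounds *)
     (forall v, energy A e N id rnd T v <= K * up_log 2 (up_log 2 n) + K) /\
     (* CONGEST: every message has O(log n) bits, i.e. value < N ^ B *)
     (forall r v u m, r < T -> e v u -> is_awake A (run A e N id rnd r v) r ->
        send A (run A e N id rnd r v) r (id u) = Some m -> m < N ^ B) /\
     (* the output is always an independent set *)
     independent e (out_set A e N id f T)) /\
  (* it is maximal with probability >= 1 - n^(-p/q) over the random bits *)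
  #|[set f : {ffun 'I_n -> (rbits A N).-tuple bool}
       | ~~ maximal_independent e (out_set A e N id f T)]| ^ q * n ^ p
    <= #|{ffun 'I_n -> (rbits A N).-tuple bool}| ^ q.
Proof.
move=> d; have [K1 timeK] := time_bound d; have [K2 energyK] := energy_bound d.
(* One constant serves both time and energy; 24 comes from [message_size], and [p = q = 1] as the
   failure probability is at most [1 / n]. *)
exists mis_algo, (K1 + K2), 24, 1, 1; split=> //; split=> //.
move=> n e e_sym e_irr N /andP[nN Nd] id id_inj id_lt.
set T := (K1 + K2) * _ + _; rewrite /=.
have lateT : (last_slot N).*2 <= T.
  by apply: leq_trans (timeK n N Nd) _; rewrite /T mulnDl; lia.
have outE (f : {ffun 'I_n -> (rbits mis_algo N).-tuple bool}) :
    out_set mis_algo e N id f T = joined (ideal e N id (fun v => tval (f v)) (last_slot N)).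
  by rewrite -(output_set id (fun v => tval (f v)) e_sym lateT).
split=> [f|].
  split; first by move=> v; apply: terminated.
  split.
    move=> v; apply: leq_trans (energy_le _ _ _ _ _ _) _.
    by apply: leq_trans (energyK n N Nd) _; rewrite mulnDl; lia.
  split; last by rewrite outE; apply: independent_joined.
  move=> r v u m _ evu _ sent.
  (* A message travels along an edge, which forces [n >= 2]. *)
  have N1 : 1 < N.
    apply: leq_trans nN; rewrite ltnNge; apply/negP => n1.
    have uv : u = v by apply: ord_inj; have := ltn_ord u; have := ltn_ord v; lia.
    by rewrite uv e_irr in evu.
  exact: leq_trans (message_bound sent) (message_size N1).
rewrite !expn1; apply: leq_trans (not_sparse_rare id e_irr nN).
(* Whenever the remainder after the random runs is sparse, the last run decides every node; so only
   the rare dense remainders can spoil maximality. *)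
rewrite leq_mul2r; apply/orP; right; apply: subset_leq_card; apply/subsetP => f.
rewrite !inE; apply: contra => sp; rewrite outE.
by apply: maximal_joined => //; apply: undec_final.
Qed.
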